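(* Let $\Gamma$ be a $*$-semigroup with unit $e$ and let $\mathcal{X}$ be a locally bounded topological vector space with topological conjugate $Z$-dual space $\mathcal{X}_Z^*$, for an admissible space $Z$. Let $T\colon\Gamma\to\mathcal{L}(\mathcal{X},\mathcal{X}_Z')$, $s\mapsto T_s=T(s)$, be subject to the following properties: (a) $T$ is an $\mathcal{L}(\mathcal{X},\mathcal{X}_Z')$-valued positive semidefinite map, that is, $\sum_{i,j=1}^n(T_{s_i^*s_j}x_j)(x_i)\ge 0$ for all $n\in\mathbb{N}$, $s_1,\dots,s_n\in\Gamma$, $x_1,\dots,x_n\in\mathcal{X}$. (b) For all $u\in\Gamma$ there is a constant $c(u)\ge 0$ such that for all $n\in\mathbb{N}$, all $s_1,\dots,s_n\in\Gamma$, and all $x_1,\dots,x_n\in\mathcal{X}$ we have $$\sum_{i,j=1}^n(T_{s_i^*u^*us_j}x_j)(x_i)\le c(u)^2\sum_{i,j=1}^n(T_{s_i^*s_j}x_j)(x_i).$$ (c) $T(e)\in\mathcal{L}_{\mathrm{c}}(\mathcal{X},\mathcal{X}_Z^* )$. Then there exist a VH-space $\mathcal{K}$ over $Z$, a $*$-representation $\pi\colon\Gamma\to\mathcal{B}^*(\mathcal{K})$ and an operator $A\in\mathcal{L}_{\mathrm{c}}(\mathcal{X},\mathcal{K})$ such that: (i) $T_s=A^*\pi(s)A$ for any $s\in\Gamma$. (ii) $T_s\in\mathcal{L}_{\mathrm{c}}(\mathcal{X},\mathcal{X}_Z^* )$ for all $s\in\Gamma$. (iii) If $(u_l)_{l\in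 L}$ is a net in $\Gamma$ with $\sup_{l\in L}c(u_l)<\infty$ and, for some $u\in\Gamma$ and any $s,t\in\Gamma$, the net $(T_{su_lt})_{l\in L}$ converges to $T_{sut}$ in the weak topology of $\mathcal{L}_{\mathrm{c}}(\mathcal{X},\mathcal{X}_Z^* )$, then $(\pi(u_l))_{l\in L}$ converges to $\pi(u)$ in the weak topology of $\mathcal{B}^*(\mathcal{K})$.
   Context: Ordered $*$-space: a complex vector space $Z$ with (a1) an involution $z\mapsto z^*$ that is conjugate linear and satisfies $(z^* )^*=z$; (a2) a convex cone $Z_+\subseteq Z$ ($sx+ty\in Z_+$ for all real $s,t\ge 0$ and $x,y\in Z_+$) that is strict ($Z_+\cap -Z_+=\{0\}$) and consists of selfadjoint elements only. One writes $z_1\ge z_2$ if $z_1-z_2\in Z_+$. $Z$ is topologically ordered if moreover (a3) $Z$ is a Hausdorff locally convex space; (a4) $Z_+$ is closed; (a5) the topology has a base linearly generated by a family of neighbourhoods of $0$ that are absolutely convex and solid ($x\in N$ and $0\le y\le x$ imply $y\in N$); equivalently, the topology is defined by a family of seminorms $p$ that are increasing ($0\le x\le y$ implies $p(x)\le p(y)$). $S(Z)$ denotes the collection of all increasing continuous seminorms on $Z$. $Z$ is admissible if in addition (a6) its topology is complete. VE-space over $Z$: a complex vector space $\mathcal{E}$ with a $Z$-valued inner product $[\cdot,\cdot]_{\mathcal{E}}\colon\mathcal{E}\times\mathcal{E}\to Z$ such that $[x,x]\ge 0$ with $[x,x]=0$ iff $x=0$; $[x,y]=[y,x]^*$; and $[\cdot,\cdot]$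 is linear in the second variable. It carries the Hausdorff locally convex topology defined by the seminorms $h\mapsto p([h,h])^{1/2}$, $p\in S(Z)$. If $Z$ and $\mathcal{E}$ are both complete, $\mathcal{E}$ is a VH-space over $Z$. A linear operator $S\colon\mathcal{K}\to\mathcal{K}$ is bounded if there is $C\ge0$ with $[Se,Se]\le C^2[e,e]$ for all $e$; it is adjointable if there is a linear operator $S^*\colon\mathcal{K}\to\mathcal{K}$ with $[Se,f]=[e,S^*f]$ for all $e,f$. $\mathcal{B}^*(\mathcal{K})$ is the $*$-algebra of all bounded adjointable linear operators on $\mathcal{K}$. A $*$-semigroup is a semigroup $\Gamma$ with an involution $*$ such that $(\xi\eta)^*=\eta^*\xi^*$ and $(\xi^* )^*=\xi$. A $*$-representation is a multiplicative map $\pi$ with $\pi(\xi^* )=\pi(\xi)^*$. A topological vector space is locally bounded if it has a bounded neighbourhood of $0$. $\mathcal{X}_Z'$ is the vector space of all conjugate linear functions from $\mathcal{X}$ to $Z$; $\mathcal{L}(\mathcal{X},\mathcal{X}_Z')$ is the space of all linear operators $\mathcal{X}\to\mathcal{X}_Z'$. $\mathcal{X}_Z^*\subseteq\mathcal{X}_Z'$ is the subspace of continuous conjugate linear functions, with the topology of uniform convergence on bounded subsets of $\mathcal{X}$: a net $(f_i)$ converges to $0$ if for every bounded $B\subset\mathcal{X}$, every $p\in S(Z)$ and every $\epsilon>0$ there is $i_0$ such that $p(f_i(y))<\epsilon$ for all $y\in B$ and $i\ge i_0$. $\mathcal{L}_{\mathrm{c}}(\cdot,\cdot)$ denotes the space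 of all continuous linear operators. For $A\in\mathcal{L}_{\mathrm{c}}(\mathcal{X},\mathcal{K})$ the topological $Z$-adjoint operator $A^*\colon\mathcal{K}\to\mathcal{X}_Z^*$ is defined by $(A^*f)(x)=[Ax,f]_{\mathcal{K}}$, $f\in\mathcal{K}$, $x\in\mathcal{X}$. Weak convergence of a net $(S_l)$ to $S$ in $\mathcal{L}_{\mathrm{c}}(\mathcal{X},\mathcal{X}_Z^* )$ means $(S_ly)(x)\to(Sy)(x)$ in $Z$ for all $x,y\in\mathcal{X}$; weak convergence of $(B_l)$ to $B$ in $\mathcal{B}^*(\mathcal{K})$ means $[g,B_lh]_{\mathcal{K}}\to[g,Bh]_{\mathcal{K}}$ in $Z$ for all $g,h\in\mathcal{K}$. The constants $c(u)$ in (iii) are those fixed in (b). *)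

(* Defs.v *)
From HB Require Import structures.
From mathcomp Require Import all_boot all_order all_algebra complex lra ring.
From mathcomp Require Import all_classical all_reals all_analysis.

Set Implicit Arguments.
Unset Strict Implicit.
Unset Printing Implicit Defensive.

Import Order.TTheory GRing.Theory Num.Theory.
Import numFieldNormedType.Exports.

Local Open Scope classical_set_scope.
Local Open Scope ring_scope.
Local Open Scope complex_scope.

(* A *-semigroup with unit is a [starMonoidType]; the library writes the
   involution of such a monoid as an inverse. *)
Notation "s ^*" := (monoid.inv s) : group_scope.

Section TopologicalVectorSpaces.
Variable R : realType.

(* The uniform structure carried by a [tvsType] need not be translation
   invariant, so Cauchy filters are defined from the neighbourhoods of 0. *)
Definition tvs_cauchy (E : tvsType R[i]) (F : set_system E) : Prop :=
  forall U : set E, nbhs 0 U ->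
    exists2 A, F A & forall x y, A x -> A y -> U (x - y).

Definition tvs_complete (E : tvsType R[i]) : Prop :=
  forall F : set_system E, ProperFilter F -> tvs_cauchy F ->
    exists x : E, F --> x.

Definition tvs_bounded (E : topologicalLmodType R[i]) (B : set E) : Prop :=
  forall U : set E, nbhs 0 U ->
    exists2 r : R, 0 < r &
      forall a : R[i], r%:C <= `|a| -> B `<=` [set a *: u | u in U].

Definition locally_bounded (E : topologicalLmodType R[i]) : Prop :=
  exists2 B : set E, nbhs 0 B & tvs_bounded B.

(* The norm of R[i] is itself R[i]-valued. *)
Definition seminorm (E : lmodType R[i]) (p : E -> R) : Prop :=
  (forall x y, p (x + y) <= p x + p y) /\
  (forall a x, (p (a *: x))%:C = `|a| * (p x)%:C).

Definition topology_defined_by (E : tvsType R[i]) (P : set (E -> R)) : Prop :=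
  forall (x : E) (U : set E), nbhs x U <->
    exists (n : nat) (p : 'I_n -> E -> R) (e : R),
      [/\ forall i, P (p i), 0 < e
        & [set y | forall i, p i (y - x) < e] `<=` U].

Lemma seminorm0 (E : lmodType R[i]) (p : E -> R) : seminorm p -> p 0 = 0.
Proof. by case=> _ /(_ 0 0); rewrite scale0r normr0 mul0r => -[]. Qed.

Lemma seminormZ (E : lmodType R[i]) (p : E -> R) (a : R) x :
  seminorm p -> 0 <= a -> p (a%:C *: x) = a * p x.
Proof.
case=> _ pZ a0; apply: (@complexI R).
by rewrite pZ ger0_norm ?ler0c// rmorphM.
Qed.

Lemma seminorm_unit (E : lmodType R[i]) (p : E -> R) (a : R[i]) x :
  seminorm p -> `|a| = 1 -> p (a *: x) = p x.
Proof. by case=> _ pZ a1; apply: (@complexI R); rewrite pZ a1 mul1r. Qed.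

Lemma seminorm_ge0 (E : lmodType R[i]) (p : E -> R) x :
  seminorm p -> 0 <= p x.
Proof.
move=> ps; have [pD _] := ps.
have pN : p (- x) = p x by rewrite -scaleN1r seminorm_unit// normrN1.
have := pD x (- x); rewrite pN subrr (seminorm0 ps) -mulr2n.
by rewrite pmulrn_lge0.
Qed.

End TopologicalVectorSpaces.

(* L_c(X, Y) *)
Record contLinear (R : realType) (X Y : preTopologicalLmodType R[i]) :=
  ContLinear {
    contLinear_fun :> {linear X -> Y} ;
    contLinear_continuous : continuous contLinear_fun }.

Record orderedStarSpace (R : realType) (Z : lmodType R[i]) := OrderedStarSpace {
  star : Z -> Z ;
  cone : set Z ;
  starK : involutive star ;
  star_conj_linear :
    forall (a : R[i]) x y, star (a *: x + y) = a^*%R *: star x + star y ;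
  cone_convex : forall (s t : R) x y, 0 <= s -> 0 <= t -> cone x -> cone y ->
    cone (s%:C *: x + t%:C *: y) ;
  cone_strict : cone `&` [set - x | x in cone] = [set 0] ;
  cone_selfadjoint : forall x, cone x -> star x = x }.

Definition ordered_le (R : realType) (Z : lmodType R[i])
  (O : orderedStarSpace Z) (x y : Z) : Prop := cone O (y - x).

(* Local convexity is part of [tvsType]. *)
Record topOrderedSpace (R : realType) := TopOrderedSpace {
  tos_sort :> tvsType R[i] ;
  tos_order : orderedStarSpace tos_sort ;
  tos_hausdorff : hausdorff_space tos_sort ;
  tos_closed : closed (cone tos_order) ;
  tos_topology : exists P : set (tos_sort -> R),
    (forall p, P p -> seminorm p /\
      forall x y, ordered_le tos_order 0 x -> ordered_le tos_order x y ->
        p x <= p y) /\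
    topology_defined_by P }.

Definition zstar (R : realType) (Z : topOrderedSpace R) : Z -> Z :=
  star (tos_order Z).

Definition zle (R : realType) (Z : topOrderedSpace R) : Z -> Z -> Prop :=
  ordered_le (tos_order Z).

Record admissibleSpace (R : realType) := AdmissibleSpace {
  adm_tos :> topOrderedSpace R ;
  adm_complete : tvs_complete adm_tos }.

(* S(Z) *)
Definition incr_seminorm (R : realType) (Z : topOrderedSpace R)
    (p : Z -> R) : Prop :=
  [/\ seminorm p, continuous p
    & forall x y, zle 0 x -> zle x y -> p x <= p y].

Record VEspace (R : realType) (Z : topOrderedSpace R) := VESpace {
  ve_sort :> tvsType R[i] ;
  gram : ve_sort -> ve_sort -> Z ;
  gram_ge0 : forall x, zle 0 (gram x x) ;
  gram_eq0 : forall x, gram x x = 0 <-> x = 0 ;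
  gram_star : forall x y, gram x y = zstar (gram y x) ;
  gram_linear : forall (a : R[i]) x y z,
    gram x (a *: y + z) = a *: gram x y + gram x z ;
  ve_topology : topology_defined_by
    [set (fun h => Num.sqrt (p (gram h h))) | p in @incr_seminorm R Z] }.

Record VHspace (R : realType) (Z : admissibleSpace R) := VHSpace {
  vh_ve :> VEspace Z ;
  vh_complete : tvs_complete vh_ve }.

Section Operators.
Variables (R : realType) (Z : topOrderedSpace R) (K : VEspace Z).

Definition bounded_operator (S : {linear K -> K}) : Prop :=
  exists2 C : R, 0 <= C &
    forall k, zle (gram (S k) (S k)) ((C ^+ 2)%:C *: gram k k).

Definition is_adjoint (S S' : {linear K -> K}) : Prop :=
  forall k f, gram (S k) f = gram k (S' f).

(* B^*(K) *)
Record boundedAdjointable := BoundedAdjointable {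
  ba_fun :> {linear K -> K} ;
  ba_bounded : bounded_operator ba_fun ;
  ba_adjointable : exists S' : {linear K -> K}, is_adjoint ba_fun S' }.

(* Adjoints are unique, so the last conjunct says pi (s ^* ) = (pi s) ^*.
   A representation need not send the unit to the identity. *)
Definition star_representation (G : starMonoidType)
    (pi : G -> boundedAdjointable) : Prop :=
  (forall (s t : G) k, pi (s * t)%g k = pi s (pi t k)) /\
  (forall s : G, is_adjoint (pi s) (pi (s^*)%g)).

Lemma gramDr (x y z : K) : gram x (y + z) = gram x y + gram x z.
Proof. by rewrite -[y in LHS]scale1r gram_linear scale1r. Qed.

Lemma gram0r (x : K) : gram x 0 = 0.
Proof. by apply: (addIr (gram x 0)); rewrite -gramDr !add0r. Qed.

Lemma gramZr (a : R[i]) (x y : K) : gram x (a *: y) = a *: gram x y.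
Proof. by rewrite -[a *: y]addr0 gram_linear gram0r addr0. Qed.

Lemma gram_linearl (a : R[i]) (x y z : K) :
  gram (a *: x + y) z = a^*%R *: gram x z + gram y z.
Proof.
by rewrite gram_star gram_linear /zstar star_conj_linear -!/(zstar _) -!gram_star.
Qed.

Lemma gramDl (x y z : K) : gram (x + y) z = gram x z + gram y z.
Proof. by rewrite -[x in LHS]scale1r gram_linearl rmorph1 scale1r. Qed.

Lemma gram0l (x : K) : gram 0 x = 0.
Proof. by apply: (addIr (gram 0 x)); rewrite -gramDl !add0r. Qed.

Lemma gramZl (a : R[i]) (x y : K) : gram (a *: x) y = a^*%R *: gram x y.
Proof. by rewrite -[a *: x]addr0 gram_linearl gram0l addr0. Qed.

Lemma gram_polar (w : R[i]) (x y : K) : `|w| = 1 ->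
  w^*%R *: gram (x + w *: y) (x + w *: y) =
  w^*%R *: (gram x x + gram y y) + (gram x y + (w^* * w^*)%R *: gram y x).
Proof.
move=> w1; have ww : (w^* * w)%R = 1 by rewrite mulrC -sqr_normc w1 expr1n.
rewrite gramDl !gramDr !gramZl !gramZr !scalerDr !scalerA ww scale1r.
by rewrite -mulrA ww mulr1 [X in _ + X]addrC addrACA.
Qed.

Lemma gram_polarization (x y : K) :
  4%:R *: gram x y = \sum_(w <- [:: 1; -1; 'i%C; - 'i%C] : seq R[i])
    w^*%R *: gram (x + w *: y) (x + w *: y).
Proof.
have i1 : `|'i%C : R[i]| = 1 by rewrite normc_def /= expr0n expr1n add0r sqrtr1.
have ic : ('i%C : R[i])^*%R = - 'i%C by apply/eqP; rewrite eq_complex /= oppr0 !eqxx.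
rewrite !big_cons big_nil !gram_polar ?normrN ?normr1 ?i1// addr0.
rewrite !rmorphN !rmorph1 /= ic.
rewrite !mulrNN -!expr2 sqr_i expr1n.
rewrite !scaleN1r !scaleNr !scale1r.
set S := gram x x + _; set g := gram x y; set h := gram y x.
rewrite addrA [S + _ + _]addrACA subrr add0r.
rewrite [- ('i%C *: S) + _ + _]addrACA subrr add0r.
by rewrite [RHS]addrACA [_ + (g - h)]addrACA subrr addr0 scaler_nat -!mulr2n -mulrnA.
Qed.

Lemma gram_le (w : R[i]) (x y : K) : `|w| = 1 ->
  zle (gram (x + w *: y) (x + w *: y)) (2%:R *: (gram x x + gram y y)).
Proof.
move=> w1; have ww : (w^* * w)%R = 1 by rewrite mulrC -sqr_normc w1 expr1n.
have -> : gram y y = gram (w *: y) (w *: y).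
  by rewrite gramZl gramZr scalerA ww scale1r.
set v := w *: y; rewrite /zle /ordered_le.
suff -> : 2%:R *: (gram x x + gram v v) - gram (x + v) (x + v) =
    gram (x - v) (x - v) by have := gram_ge0 (x - v); rewrite /zle /ordered_le subr0.
apply/eqP; rewrite subr_eq; apply/eqP.
have gNr (a b : K) : gram a (- b) = - gram a b by apply: (addIr (gram a b)); rewrite -gramDr !addNr gram0r.
have gNl (a b : K) : gram (- a) b = - gram a b. by apply: (addIr (gram a b)); rewrite -gramDl !addNr gram0l.
rewrite !gramDl !gramDr !gNl !gNr opprK scaler_nat mulr2n.
by rewrite addrACA [RHS]addrACA; congr (_ + _);
  rewrite [RHS]addrACA addNr ?subrr ?addr0 ?add0r.
Qed.

Lemma gram_bound (p : Z -> R) (x y : K) : incr_seminorm p ->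
  p (gram x y) <= 2 * (p (gram x x) + p (gram y y)).
Proof.
move=> [ps _ pi]; have [pD _] := ps.
have i1 : `|'i%C : R[i]| = 1 by rewrite normc_def /= expr0n expr1n add0r sqrtr1.
have pw w : `|w| = 1 -> p (w^*%R *: gram (x + w *: y) (x + w *: y)) <=
    2 * (p (gram x x) + p (gram y y)).
  move=> w1; rewrite seminorm_unit ?norm_conjC//.
  apply: le_trans (pi _ _ (gram_ge0 _) (gram_le _ _ w1)) _.
  by rewrite -(rmorph_nat (real_complex R)) seminormZ// ler_wpM2l.
have : p (4%:R *: gram x y) <= 4 * (2 * (p (gram x x) + p (gram y y))).
  rewrite gram_polarization !big_cons big_nil addr0.
  set b := 2 * _ in pw *.
  have -> : 4 * b = b + (b + (b + b)) by rewrite mulr_natl !mulrS addr0.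
  by do 3 (apply: le_trans (pD _ _) _; apply: lerD; first by
    apply: pw; rewrite ?normrN ?normr1 ?i1); apply: pw; rewrite normrN.
by rewrite -(rmorph_nat (real_complex R)) seminormZ// ler_pM2l.
Qed.

End Operators.

Section ConjugateDual.
Variables (R : realType) (X Z : lmodType R[i]).

Definition conj_linear (f : X -> Z) : Prop :=
  forall (a : R[i]) x y, f (a *: x + y) = a^*%R *: f x + f y.

Definition conj_linear_pred : {pred X -> Z} := fun f => `[< conj_linear f >].

(* X'_Z *)
Record conjDual := ConjDual {
  conjDual_fun :> X -> Z ;
  conjDual_subproof : conj_linear_pred conjDual_fun }.

HB.instance Definition _ := [isSub for conjDual_fun].
HB.instance Definition _ := [Choice of conjDual by <:].

Lemma conj_linear_submod_closed : submod_closed conj_linear_pred.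
Proof.
split=> [|b f g /asboolP fP /asboolP gP]; apply/asboolP => a x y.
  by rewrite /= -[LHS]/0 -[X in _ + X]/0 -[X in _ *: X]/0 scaler0 addr0.
have E h : (b *: f + g) h = b *: f h + g h by [].
by rewrite !E fP gP !scalerDr !scalerA [b * _]mulrC addrACA.
Qed.

HB.instance Definition _ := GRing.isSubmodClosed.Build _ _ conj_linear_pred
  conj_linear_submod_closed.

HB.instance Definition _ := [SubChoice_isSubLmodule of conjDual by <:].

Lemma conjDualP (f : conjDual) : conj_linear f.
Proof. exact/asboolP/(conjDual_subproof f). Qed.

End ConjugateDual.

Section ContinuousConjugateDual.
Variables (R : realType) (X : topologicalLmodType R[i]).

Section Space.
Variable Z : topOrderedSpace R.

Definition contDual_pred : {pred conjDual X Z} :=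
  fun f => `[< continuous (f : X -> Z) >].

(* X^*_Z *)
Record contDual := ContDual {
  contDual_val :> conjDual X Z ;
  contDual_subproof : contDual_pred contDual_val }.

HB.instance Definition _ := [isSub for contDual_val].
HB.instance Definition _ := [Choice of contDual by <:].

Lemma contDual_submod_closed : submod_closed contDual_pred.
Proof.
split=> [|b f g /asboolP fP /asboolP gP]; apply/asboolP.
  by move=> x; exact: (@cvg_cst Z).
move=> x.
apply: (@continuous_comp _ _ _ (fun x => (b *: f x, g x))
  (fun z : Z * Z => z.1 + z.2)); last exact: add_continuous.
apply: cvg_pair; last exact: gP.
apply: (@continuous_comp _ (R[i]^o * Z)%type _ (fun x => (b, f x))
  (fun z : R[i]^o * Z => z.1 *: z.2)); last exact: scale_continuous.
by apply: (@cvg_pair _ _ _ _ (nbhs (b : R[i]^o))); [exact: cvg_cst|exact: fP].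
Qed.

HB.instance Definition _ := GRing.isSubmodClosed.Build _ _ contDual_pred
  contDual_submod_closed.

HB.instance Definition _ := [SubChoice_isSubLmodule of contDual by <:].

Lemma contDual_continuous (f : contDual) : continuous (f : X -> Z).
Proof. exact/asboolP/(contDual_subproof f). Qed.

(* Bounded sets and S(Z) are closed under finite unions and sums, so a single
   pair (B, p) suffices for uniform convergence on bounded sets. *)
Definition contDual_nbhs (f : contDual) : set_system contDual :=
  [set U | exists (B : set X) (p : Z -> R) (e : R),
    [/\ tvs_bounded B, incr_seminorm p, 0 < e
      & [set g : contDual | forall y, B y -> p (g y - f y) < e] `<=` U]].

Lemma incr_seminormD (p q : Z -> R) :
  incr_seminorm p -> incr_seminorm q -> incr_seminorm (p \+ q).
Proof.
move=> [[pD pZ] pc pi] [[qD qZ] qc qi]; split=> [|x|x y x0 xy].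
- split=> [x y|a x] /=; first by rewrite addrACA lerD.
  by rewrite !rmorphD /= pZ qZ mulrDr.
- exact: cvgD (pc x) (qc x).
- by rewrite lerD ?pi ?qi.
Qed.

Lemma tvs_boundedU (B C : set X) :
  tvs_bounded B -> tvs_bounded C -> tvs_bounded (B `|` C).
Proof.
move=> hB hC U U0; have [r r0 rB] := hB U U0; have [s s0 sC] := hC U U0.
exists (r + s); first exact: addr_gt0.
move=> a ra; by rewrite subUset; split; [apply: rB|apply: sC];
  apply: le_trans ra; rewrite lecR ?lerDl ?lerDr ltW.
Qed.

Lemma tvs_bounded0 : tvs_bounded (set0 : set X).
Proof. by move=> U _; exists 1 => // a _ x. Qed.

Lemma incr_seminorm0 : incr_seminorm (fun _ : Z => 0 : R).
Proof.
split=> [|x|//]; last exact: cvg_cst.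
by split=> [x y|a x]; rewrite ?addr0 ?mulr0.
Qed.

Lemma contDual_nbhs_filter f : ProperFilter (contDual_nbhs f).
Proof.
split.
  move=> [B [p [e [_ [ps _ _] e0 /(_ f)]]]]; apply => y _.
  by rewrite subrr seminorm0.
split.
- exists set0, (fun=> 0), 1; split => //; [exact: tvs_bounded0|].
  exact: incr_seminorm0.
- move=> U V [B [p [d [hB hp d0 BU]]]] [C [q [e [hC hq e0 CV]]]].
  exists (B `|` C), (p \+ q), (Num.min d e); split.
  + exact: tvs_boundedU.
  + exact: incr_seminormD.
  + by rewrite lt_min d0.
  + have [ps _ _] := hp; have [qs _ _] := hq.
    move=> g hg; split; [apply: BU|apply: CV] => y By.
      have := hg y (or_introl By); rewrite lt_min => /andP[+ _].
      by apply: le_lt_trans; rewrite /= lerDl seminorm_ge0.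
    have := hg y (or_intror By); rewrite lt_min => /andP[_].
    by apply: le_lt_trans; rewrite /= lerDr seminorm_ge0.
- move=> U V UV [B [p [e [hB hp e0 BU]]]].
  by exists B, p, e; split=> //; exact: subset_trans UV.
Qed.

Lemma contDual_nbhs_singleton f U : contDual_nbhs f U -> U f.
Proof.
move=> [B [p [e [_ [ps _ _] e0]]]]; apply => y _.
by rewrite subrr seminorm0.
Qed.

Lemma contDual_nbhs_nbhs f U :
  contDual_nbhs f U -> contDual_nbhs f (contDual_nbhs^~ U).
Proof.
move=> [B [p [e [hB hp e0 BU]]]]; have [[pD _] _ _] := hp.
exists B, p, (e / 2); split=> //; first by rewrite divr_gt0.
move=> g hg; exists B, p, (e / 2); split=> //; first by rewrite divr_gt0.
move=> h hh; apply: BU => y By.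
have -> : h y - f y = (h y - g y) + (g y - f y) by rewrite addrA subrK.
by apply: le_lt_trans (pD _ _) _; rewrite [e]splitr ltrD ?hg ?hh.
Qed.

HB.instance Definition _ := hasNbhs.Build contDual contDual_nbhs.
HB.instance Definition _ := Nbhs_isNbhsTopological.Build contDual
  contDual_nbhs_filter contDual_nbhs_singleton contDual_nbhs_nbhs.

(* S, given as an operator into X'_Z, belongs to L_c(X, X^*_Z): it takes its
   values in X^*_Z and is continuous for the topology of X^*_Z. *)
Definition in_Lc (S : {linear X -> conjDual X Z}) : Prop :=
  exists S' : contLinear X contDual, forall x, S x = S' x.

End Space.

Section Adjoint.
Variables (Z : topOrderedSpace R) (K : VEspace Z) (A : contLinear X K).

Definition Zadjoint_fun (f : K) (x : X) : Z := gram (A x) f.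

Fact Zadjoint_conj_linear f : conj_linear_pred (Zadjoint_fun f).
Proof. by apply/asboolP => a x y; rewrite /Zadjoint_fun linearP gram_linearl. Qed.

Fact Zadjoint_continuous f :
  contDual_pred (ConjDual (Zadjoint_conj_linear f)).
Proof.
apply/asboolP => x U.
have [P [Pinc Ptop]] := tos_topology Z.
move=> /(Ptop (Zadjoint_fun f x)) [n [p [e [pP e0 pU]]]].
suff : \forall y \near x, forall i, p i (Zadjoint_fun f y - Zadjoint_fun f x) < e.
  by apply: filterS => y hy; exact: pU.
apply: filter_forall => i; set q := p i.
have qP : P q := pP i.
have [qs qinc] := Pinc _ qP; have [qD _] := qs.
have qS : incr_seminorm q.
  split=> // z V /(nbhs_ballP _ _)[d d0 dV].
  apply/(Ptop z); exists 1%N, (fun=> q), d; split=> // w /(_ ord0) qwz.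
  apply: dV; rewrite -ball_normE /= distrC ltr_norml.
  have qN : q (z - w) = q (w - z).
    by rewrite -opprB -scaleN1r seminorm_unit// normrN1.
  have := qD (w - z) z; rewrite subrK => h1.
  have := qD (z - w) w; rewrite subrK qN => h2.
  by apply/andP; split; lra.
pose t := e / (4 * (q (gram f f) + 1)).
have qf0 := seminorm_ge0 (gram f f) qs.
have t0 : 0 < t by rewrite divr_gt0// mulr_gt0// ltr_wpDl.
have te0 : 0 < t * e / 4 by rewrite divr_gt0// mulr_gt0.
have nA : nbhs (A x) [set k | q (gram (k - A x) (k - A x)) < t * e / 4].
  apply/(@ve_topology _ _ K); exists 1%N, (fun _ h => Num.sqrt (q (gram h h))).
  exists (Num.sqrt (t * e / 4)); split=> [_||k /(_ ord0)].
  - by exists q.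
  - by rewrite sqrtr_gt0.
  - by rewrite ltr_sqrt.
have := @contLinear_continuous _ _ _ A x _ nA.
apply: (@filterS _ _ (nbhs_filter x)) => y /= hy.
rewrite /Zadjoint_fun.
have -> : gram (A y) f - gram (A x) f = gram (A y - A x) f.
  by apply/eqP; rewrite subr_eq -gramDl subrK.
set u := A y - A x in hy *.
have := gram_bound u (t%:C *: f) qS.
have qJ z : q (t%:C^*%R *: z) = t * q z.
  by apply: (@complexI R); rewrite qs.2 norm_conjC ger0_norm ?ler0c ?rmorphM// ltW.
rewrite gramZl !gramZr qJ !seminormZ ?(ltW t0)//.
have te : t * q (gram f f) <= e / 4.
  have : t * (4 * (q (gram f f) + 1)) = e.
    by rewrite divfK// gt_eqF// mulr_gt0// ltr_wpDl.
  lra.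
have : t * (t * q (gram f f)) <= t * (e / 4) by rewrite ler_pM2l.
by rewrite -(ltr_pM2l t0); lra.
Qed.

Definition Zadjoint (f : K) : contDual Z := ContDual (Zadjoint_continuous f).

End Adjoint.

End ContinuousConjugateDual.

Definition directed (L : Type) (le : L -> L -> Prop) : Prop :=
  [/\ inhabited L, forall i, le i i,
      forall i j k, le i j -> le j k -> le i k
    & forall i j, exists k, le i k /\ le j k].

(* The filter of tails: f @ tails le --> z is convergence of the net f to z. *)
Definition tails (L : Type) (le : L -> L -> Prop) : set_system L :=
  filter_from [set: L] (fun i => [set j | le i j]).

Definition weak_cvg_Lc (R : realType) (X : topologicalLmodType R[i])
    (Z : topOrderedSpace R) (L : Type) (le : L -> L -> Prop)
    (S_ : L -> {linear X -> conjDual X Z}) (S : {linear X -> conjDual X Z})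
    : Prop :=
  forall x y : X, S_ l y x @[l --> tails le] --> S y x.

Definition weak_cvg_BA (R : realType) (Z : topOrderedSpace R) (K : VEspace Z)
    (L : Type) (le : L -> L -> Prop)
    (B_ : L -> boundedAdjointable K) (B : boundedAdjointable K) : Prop :=
  forall g h : K, gram g (B_ l h) @[l --> tails le] --> gram g (B h).

(* Main.v *)
From HB Require Import structures.
Require Import Defs.
From mathcomp Require Import all_boot all_order all_algebra complex lra.
From mathcomp Require Import all_classical all_reals all_analysis.

Set Implicit Arguments.
Unset Strict Implicit.
Unset Printing Implicit Defensive.

Import Order.TTheory GRing.Theory Num.Theory.
Import numFieldNormedType.Exports.

Local Open Scope classical_set_scope.
Local Open Scope ring_scope.
Local Open Scope complex_scope.

(** The theorem is a Gelfand-Naimark-Segal construction. On finite lists of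
    pairs in G * X, read as formal sums, put
      [w, v] = the sum of T (s^-1 * t) y x over (s, x) in w and (t, y) in v,
    where the inverse stands for the involution of G. Positivity of T says
    that this form is positive semidefinite. The monoid G acts on lists by left
    translation, the translations by u and by the star of u are adjoint to each
    other, and the bound on T says that translation by u is bounded with
    constant c u. The space K is the Hausdorff completion of the lists, pi
    extends the action, A sends x to the class of the list [(1, x)], and then
      T s x y = [(1, y), (s, x)] = [A y, pi s (A x)].

    The completion is realised as a space of functions, like a reproducing
    kernel space: an element h of K is the function sending a list w to what
    will be its inner product with h. A function belongs to K when the
    functions [_, v] approximate it, with an error at w controlled by the norm
    of w for each increasing seminorm ([approximable]). In this picture K is a
    linear subspace of all functions, no equivalence classes or Cauchy filters
    appear in its elements, pi u is composition with translation by the star of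
    u, and completeness is the usual argument for pointwise limits of functions
    that converge uniformly ([completion_complete]). The inner product [h, k]
    is the limit of k v as v tends to h ([gram_exists]), which is where
    completeness of Z enters.

    Everything rests on a Schwarz inequality with constant 4, valid for each
    increasing seminorm p of Z ([form_schwarz]):
      p [x, y] <= 4 p[x, x]^(1/2) p[y, y]^(1/2).
    The involution of Z need not be continuous, so hermitian symmetry does not
    pass to limits by itself; it is deduced on K from positivity, which does
    pass to limits because the cone is closed ([form_star]).

    Continuity of A is continuity of x |-> T 1 x x at 0, and this is where a
    bounded neighbourhood B of 0 is used: T 1 is continuous for uniform
    convergence on B, so T 1 x is small on B, in particular at x, as soon as x
    is small and in B ([generator_small]). The factorisation then makes every
    T s continuous. Weak convergence of pi (u_ l) holds by hypothesis on the
    dense images of lists, and extends to K because the constants c (u_ l) are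
    bounded ([extension_gram_approx], [dilation_weak_cvg]). *)

(** * Moduli and conjugates of complex numbers *)

Definition modulus (R : realType) (a : R[i]) : R := complex.Re `|a|.

Lemma modulusE (R : realType) (a : R[i]) : (modulus a)%:C = `|a|.
Proof. by rewrite RRe_real// normr_real. Qed.

Lemma modulus_ge0 (R : realType) (a : R[i]) : 0 <= modulus a.
Proof. by rewrite -ler0c modulusE. Qed.

Lemma modulus_conj (R : realType) (a : R[i]) : modulus (a^*%R) = modulus a.
Proof. by rewrite /modulus norm_conjC. Qed.

Lemma modulus_real (R : realType) (a : R) : 0 <= a -> modulus a%:C = a.
Proof. by move=> a0; rewrite /modulus ger0_norm ?ler0c. Qed.

Lemma conj_real (R : realType) (r : R) : (r%:C)^*%R = r%:C :> R[i].
Proof. by apply/eqP; rewrite eq_complex /= oppr0 !eqxx. Qed.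

Lemma conjM (R : realType) (a b : R[i]) : (a * b)^*%R = a^*%R * b^*%R.
Proof. exact: rmorphM. Qed.

Lemma conjN (R : realType) (a : R[i]) : (- a)^*%R = - a^*%R.
Proof. exact: rmorphN. Qed.

Lemma conj_i (R : realType) : ('i%C : R[i])^*%R = - 'i%C.
Proof. by apply/eqP; rewrite eq_complex /= oppr0 !eqxx. Qed.

(** * Locally convex spaces defined by seminorms *)

Section SeminormTopology.
Variables (R : realType) (E : lmodType R[i]).

Lemma seminormN (p : E -> R) x : seminorm p -> p (- x) = p x.
Proof. by move=> ps; rewrite -scaleN1r seminorm_unit// normrN1. Qed.

Lemma seminormBC (p : E -> R) x y : seminorm p -> p (x - y) = p (y - x).
Proof. by move=> ps; rewrite -opprB seminormN. Qed.

Lemma seminorm_triangle (p : E -> R) y x z : seminorm p ->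
  p (x - z) <= p (x - y) + p (y - z).
Proof. by case=> pD _; rewrite -[x in leLHS](subrK y) -addrA; exact: pD. Qed.

Lemma seminorm_scale (p : E -> R) (a : R[i]) x : seminorm p ->
  p (a *: x) = modulus a * p x.
Proof. by move=> ps; apply: (@complexI R); rewrite ps.2 rmorphM /= modulusE. Qed.

Lemma seminormZ_le (p : E -> R) (a : R[i]) (r : R) x : seminorm p ->
  `|a| <= r%:C -> p (a *: x) <= r * p x.
Proof.
move=> ps ar; rewrite -lecR ps.2 rmorphM ler_wpM2r// ler0c.
exact: seminorm_ge0.
Qed.

Record seminormFamily := SeminormFamily {
  seminorms : set (E -> R) ;
  seminormsP : forall p, seminorms p -> seminorm p }.

(** A copy of E that depends on the family, so that the topology can be attached
    to it canonically. *)
Definition seminormed (P : seminormFamily) : Type := E.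

Variable P : seminormFamily.
Local Notation sE := (seminormed P).

HB.instance Definition _ := GRing.Lmodule.on sE.

Definition seminorm_ball (n : nat) (p : 'I_n -> E -> R) (x : E) (e : R) : set E :=
  [set y | forall i, p i (y - x) < e].

Definition seminormed_nbhs (x : sE) : set_system sE :=
  [set U | exists (n : nat) (p : 'I_n -> E -> R) (e : R),
    [/\ forall i, seminorms P (p i), 0 < e & seminorm_ball p x e `<=` U]].

Lemma seminorm_ball_center n (p : 'I_n -> E -> R) x e :
  (forall i, seminorms P (p i)) -> 0 < e -> seminorm_ball p x e x.
Proof. by move=> pP e0 i; rewrite subrr seminorm0//; exact: (seminormsP (pP i)). Qed.

Lemma seminormed_nbhs_filter x : ProperFilter (seminormed_nbhs x).
Proof.
split.
  by move=> [n [p [e [pP e0 /(_ x)]]]]; apply; exact: seminorm_ball_center.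
split.
- exists 0%N, (fun=> fun=> 0), 1; split=> //; by case.
- move=> U V [n [p [d [pP d0 pU]]]] [m [q [e [qP e0 qV]]]].
  exists (n + m)%N, (fun i => match fintype.split i with inl j => p j | inr k => q k end).
  exists (Num.min d e); split.
  + by move=> i; case: (fintype.split i).
  + by rewrite lt_min d0.
  + move=> y yB; split; [apply: pU|apply: qV] => i.
      have := yB (unsplit (inl i)); rewrite unsplitK.
      by move=> /lt_le_trans; apply; rewrite ge_min lexx.
    have := yB (unsplit (inr i)); rewrite unsplitK.
    by move=> /lt_le_trans; apply; rewrite ge_min lexx orbT.
- move=> U V UV [n [p [e [pP e0 pU]]]].
  by exists n, p, e; split=> //; exact: subset_trans UV.
Qed.

Lemma seminormed_nbhs_singleton x U : seminormed_nbhs x U -> U x.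
Proof.
by move=> [n [p [e [pP e0]]]]; apply; exact: seminorm_ball_center.
Qed.

Lemma seminormed_nbhs_nbhs x U :
  seminormed_nbhs x U -> seminormed_nbhs x (seminormed_nbhs^~ U).
Proof.
move=> [n [p [e [pP e0 pU]]]]; have e20 : 0 < e / 2 by rewrite divr_gt0.
exists n, p, (e / 2); split=> // y xy; exists n, p, (e / 2); split=> // z yz.
apply: pU => i; rewrite [e]splitr.
apply: le_lt_trans (seminorm_triangle y _ _ (seminormsP (pP i))) _.
exact: ltrD.
Qed.

HB.instance Definition _ := hasNbhs.Build sE seminormed_nbhs.
HB.instance Definition _ := Nbhs_isNbhsTopological.Build sE
  seminormed_nbhs_filter seminormed_nbhs_singleton seminormed_nbhs_nbhs.

Lemma nbhs_seminorm_ball n (p : 'I_n -> E -> R) (x : sE) e :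
  (forall i, seminorms P (p i)) -> 0 < e -> nbhs x (seminorm_ball p x e : set sE).
Proof. by move=> pP e0; exists n, p, e; split.  Qed.

Lemma nbhs_seminorm (p : E -> R) (x : sE) e : seminorms P p -> 0 < e ->
  nbhs x [set y : sE | p (y - x) < e].
Proof. by move=> Pp e0; exists 1%N, (fun=> p), e; split=> // y /(_ ord0). Qed.

Lemma seminormed_add_continuous : continuous (fun x : sE * sE => x.1 + x.2).
Proof.
move=> [x y] U [n [p [e [pP e0 pU]]]].
have e20 : 0 < e / 2 by rewrite divr_gt0.
exists (seminorm_ball p x (e / 2), seminorm_ball p y (e / 2)).
  by split; exact: nbhs_seminorm_ball.
move=> [x' y'] [/= xx' yy']; apply: pU => i /=.
rewrite opprD addrACA [e]splitr.
apply: le_lt_trans ((seminormsP (pP i)).1 _ _) _.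
exact: ltrD.
Qed.

Lemma seminormed_scale_continuous :
  continuous (fun z : R[i]^o * sE => z.1 *: z.2).
Proof.
move=> [a x] U [n [p [e [pP e0 pU]]]].
suff : \forall z \near ((a, x) : R[i]^o * sE),
    forall i, p i (z.1 *: z.2 - a *: x) < e.
  by apply: filterS => z; exact: pU.
apply: (@filter_forall _ _ _ (nbhs ((a, x) : R[i]^o * sE))) => i.
set q := p i.
have qs : seminorm q := seminormsP (pP i).
have e20 : 0 < e / 2 by rewrite divr_gt0.
have qx0 : 0 <= q x := seminorm_ge0 x qs.
pose M := modulus a + 1.
have aM : `|a| = (M - 1)%:C by rewrite /M addrK modulusE.
have M0 : 0 < M.
  have : 0 <= M - 1 by rewrite -ler0c -aM.
  by rewrite subr_ge0; apply: lt_le_trans.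
pose d := Num.min 1 (e / 2 / (q x + 1)).
have d0 : 0 < d by rewrite lt_min ltr01 divr_gt0// ltr_wpDl.
(* b y - a x = b (y - x) + (b - a) x, where the modulus of b is less than M
   because d <= 1. *)
exists ([set b : R[i]^o | `|b - a| < d%:C], [set y : sE | q (y - x) < e / 2 / M]).
  split=> /=.
    apply/(@nbhs_ballP _ R[i]^o); exists (d%:C); first by rewrite /= ltcR.
    by move=> b; rewrite -ball_normE /= distrC.
  by apply: nbhs_seminorm; [exact: pP|rewrite divr_gt0].
move=> [b y] [/= ba yx].
have -> : b *: y - a *: x = b *: (y - x) + (b - a) *: x.
  by rewrite scalerBr scalerBl addrA subrK.
apply: le_lt_trans (qs.1 _ _) _; rewrite [e]splitr; apply: ltr_leD.
  have bM : `|b| <= M%:C.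
    rewrite -[b](subrK a) (le_trans (ler_normD _ _))// aM.
    rewrite -lerBrDr -rmorphB opprB addrCA subrr addr0 (le_trans (ltW ba))//.
    by rewrite lecR ge_min lexx.
  apply: le_lt_trans (seminormZ_le _ qs bM) _.
  by rewrite mulrC -ltr_pdivlMr.
apply: le_trans (seminormZ_le _ qs (ltW ba)) _.
have : d * (q x + 1) <= e / 2.
  by rewrite -ler_pdivlMr ?ltr_wpDl// ge_min lexx orbT.
by apply: le_trans; rewrite ler_pM2l// lerDl.
Qed.

(** Openness is what makes the balls a convex base, and not only a
    base of neighbourhoods. *)
Lemma seminorm_ball_open n (p : 'I_n -> E -> R) (x : sE) e :
  (forall i, seminorms P (p i)) -> open (seminorm_ball p x e : set sE).
Proof.
move=> pP; rewrite openE => y xy.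
change (\forall z \near y, forall i, p i (z - x) < e).
apply: (@filter_forall _ _ _ (nbhs y) (nbhs_filter y)) => i.
have qs := seminormsP (pP i).
have : nbhs y [set z : sE | p i (z - y) < e - p i (y - x)].
  by apply: nbhs_seminorm => //; rewrite subr_gt0; exact: xy.
apply: filterS => z /=; rewrite ltrBrDr; apply: le_lt_trans.
exact: seminorm_triangle.
Qed.

Lemma seminorm_ball_convex n (p : 'I_n -> E -> R) (x : sE) e :
  (forall i, seminorms P (p i)) -> convex_set (seminorm_ball p x e : set sE).
Proof.
move=> pP; apply/convex_setW => y z; rewrite !inE => xy xz l l0 l1.
rewrite inE => i; have qs := seminormsP (pP i).
have lE : l%:num = (complex.Re l%:num)%:C by rewrite RRe_real// gtr0_real.
set t := complex.Re _ in lE.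
have t0 : 0 < t by rewrite -ltcR -lE.
have t1 : 0 < 1 - t by rewrite subr_gt0 -ltcR -lE.
have -> : conv l y z - x = t%:C *: (y - x) + (1 - t)%:C *: (z - x).
  rewrite -[LHS]/(l%:num *: y + (1 - l%:num) *: z - x) lE -rmorphB.
  rewrite !scalerBr addrACA -opprD -scalerDl -rmorphD.
  by rewrite [t + _]addrC subrK scale1r.
apply: le_lt_trans (qs.1 _ _) _; rewrite !seminormZ ?ltW//.
have -> : e = t * e + (1 - t) * e by rewrite -mulrDl addrC subrK mul1r.
by rewrite ltrD// ltr_pM2l.
Qed.

Lemma seminormed_locally_convex : exists2 B : set_system sE,
  (forall b, b \in B -> convex_set b) & basis B.
Proof.
exists [set b | exists n (p : 'I_n -> E -> R) x e,
  [/\ forall i, seminorms P (p i), 0 < e & b = seminorm_ball p x e]].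
  by move=> b /[!inE] -[n [p [x [e [pP _ ->]]]]]; exact: seminorm_ball_convex.
split=> [b [n [p [x [e [pP _ ->]]]]]|x U [n [p [e [pP e0 pU]]]]].
  exact: seminorm_ball_open.
exists (seminorm_ball p x e); last exact: pU.
by split; [exists n, p, x, e|exact: seminorm_ball_center].
Qed.

HB.instance Definition _ := PreTopologicalLmod_isTvs.Build R[i] sE
  seminormed_add_continuous seminormed_scale_continuous
  seminormed_locally_convex.

HB.instance Definition _ := PreTopologicalNmodule_isTopologicalNmodule.Build sE
  seminormed_add_continuous.
HB.instance Definition _ := TopologicalNmodule_isTopologicalLmodule.Build R[i] sE
  seminormed_scale_continuous.
HB.instance Definition _ := Uniform_isTvs.Build R[i] sE seminormed_locally_convex.

Lemma seminormed_topology : @topology_defined_by R (sE : tvsType R[i]) (seminorms P).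
Proof. by []. Qed.

End SeminormTopology.

(** * Topologically ordered star-spaces *)

Section OrderedStarSpaces.
Variables (R : realType) (Z : topOrderedSpace R).
Implicit Types (x y z : Z) (p q : Z -> R).

Lemma zle0 x : zle 0 x = cone (tos_order Z) x.
Proof. by rewrite /zle /ordered_le subr0. Qed.

Lemma cone0 : cone (tos_order Z) 0.
Proof.
by have : [set 0 : Z] 0 by []; rewrite -(cone_strict (tos_order Z)) => -[].
Qed.

Lemma zstar_linear (a : R[i]) x y :
  zstar (a *: x + y) = a^*%R *: zstar x + zstar y.
Proof. exact: star_conj_linear. Qed.

Lemma zstar0 : zstar (0 : Z) = 0.
Proof. by apply: cone_selfadjoint; exact: cone0. Qed.

Lemma zstarD x y : zstar (x + y) = zstar x + zstar y.
Proof. by rewrite -[x in LHS]scale1r zstar_linear rmorph1 scale1r. Qed.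

Lemma zstarZ (a : R[i]) x : zstar (a *: x) = a^*%R *: zstar x.
Proof. by rewrite -[a *: x]addr0 zstar_linear zstar0 addr0. Qed.

Lemma incr_seminorm_le p x y : incr_seminorm p -> cone (tos_order Z) x ->
  zle x y -> p x <= p y.
Proof. by move=> [_ _ pi] x0; apply: pi; rewrite zle0. Qed.

(** From 0 <= y + x <= 2 y and 0 <= y - x <= 2 y, since 2 x is the difference of
    y + x and y - x. *)
Lemma incr_seminorm_dominated p x y : incr_seminorm p ->
  cone (tos_order Z) (y + x) -> cone (tos_order Z) (y - x) -> p x <= 2 * p y.
Proof.
move=> pI yDx yBx; have [ps _ _] := pI.
have pyD u : cone (tos_order Z) (y + u) -> cone (tos_order Z) (y - u) ->
    p (y + u) <= 2 * p y.
  move=> yDu yBu; have : zle (y + u) (2%:C *: y).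
    rewrite /zle /ordered_le.
    suff -> : 2%:C *: y - (y + u) = y - u by [].
    by rewrite rmorph_nat scaler_nat mulr2n opprD addrACA subrr add0r.
  move=> /(incr_seminorm_le pI yDu)/le_trans; apply.
  by rewrite seminorm_scale// modulus_real.
have pyx := pyD _ yDx yBx.
have pyBx : p (y - x) <= 2 * p y by apply: pyD; rewrite ?opprK.
have : p (2%:C *: x) <= p (y + x) + p (y - x).
  have -> : 2%:C *: x = (y + x) - (y - x).
    by rewrite rmorph_nat scaler_nat mulr2n opprB addrC addrA subrK.
  by apply: le_trans (ps.1 _ _) _; rewrite seminormN.
rewrite seminorm_scale// modulus_real//; lra.
Qed.

(** S(Z) is directed: a finite sum dominates its terms. Hence a single seminorm
    suffices to describe a neighbourhood, both in Z and in the completion. *)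
Lemma incr_seminorm_max n (p : 'I_n -> Z -> R) :
  (forall i, incr_seminorm (p i)) ->
  exists2 q, incr_seminorm q & forall i z, p i z <= q z.
Proof.
elim: n p => [|n IHn] p pI.
  by exists (fun=> 0); [exact: incr_seminorm0|case].
have [q qI pq] := IHn _ (fun i => pI (lift ord0 i)).
exists (p ord0 \+ q); first exact: incr_seminormD.
move=> i z /=; case: (unliftP ord0 i) => [j|] ->.
  have [ps _ _] := pI ord0.
  by rewrite (le_trans (pq j z))// lerDr seminorm_ge0.
by have [qs _ _] := qI; rewrite lerDl seminorm_ge0.
Qed.

Lemma nbhs_incr_seminorm p z e : incr_seminorm p -> 0 < e ->
  nbhs z [set y | p (y - z) < e].
Proof.
move=> [ps pc _] e0.
have U0 : nbhs (0 : Z) [set y | p y < e].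
  have := pc 0 [set r | r < e]; rewrite seminorm0//; apply.
  exact: open_nbhs_nbhs (conj (@open_lt _ e) e0).
have := nbhsT z U0; apply: filterS => _ [y py <-].
by rewrite /= addrC addKr.
Qed.

Lemma tos_nbhsP (z : Z) U : nbhs z U <->
  exists p e, [/\ incr_seminorm p, 0 < e & [set y | p (y - z) < e] `<=` U].
Proof.
split; last first.
  by move=> [p [e [pI e0 pU]]]; apply: filterS pU _; exact: nbhs_incr_seminorm.
have [P [Pinc Ptop]] := tos_topology Z.
move=> /(Ptop z)[n [p [e [pP e0 pU]]]].
have PI q : P q -> incr_seminorm q.
  move=> Pq; have [qs qi] := Pinc _ Pq; split=> // x V /(nbhs_ballP _ _)[d d0 dV].
  apply/(Ptop x); exists 1%N, (fun=> q), d; split=> // w /(_ ord0) qwx.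
  apply: dV; rewrite -ball_normE /= distrC ltr_norml.
  have h1 : q w <= q (w - x) + q x by rewrite -[w in leLHS](subrK x); exact: qs.1.
  have h2 : q x <= q (w - x) + q w.
    by rewrite seminormBC// -[x in leLHS](subrK w); exact: qs.1.
  by apply/andP; split; lra.
have [q qI pq] := incr_seminorm_max (fun i => PI _ (pP i)).
exists q, e; split=> // y /= qy; apply: pU => i.
exact: le_lt_trans (pq _ _) qy.
Qed.

Lemma tos_cvgP (F : set_system Z) (z : Z) : Filter F -> F --> z <->
  forall p e, incr_seminorm p -> 0 < e -> F [set y | p (y - z) < e].
Proof.
move=> FF; split=> [Fz p e pI e0|Fp U /tos_nbhsP[p [e [pI e0 pU]]]].
  exact/Fz/nbhs_incr_seminorm.
by apply: filterS pU _; exact: Fp.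
Qed.

(** The form in which the Hausdorff property is used: identities in Z are proved
    by estimating every increasing seminorm. *)
Lemma tos_separated (z : Z) : (forall p, incr_seminorm p -> p z <= 0) -> z = 0.
Proof.
move=> z0; apply: (@tos_hausdorff _ Z) => A B Az B0.
have [p [e [pI e0 pA]]] := (tos_nbhsP _ _).1 Az.
exists 0; split; last exact: nbhs_singleton.
by have [ps _ _] := pI; apply: pA; rewrite /= sub0r seminormN// (le_lt_trans (z0 _ pI)).
Qed.

(** The form in which closedness of the cone is used: inequalities in Z pass to
    limits. *)
Lemma cone_limit (z : Z) : (forall p e, incr_seminorm p -> 0 < e ->
  exists2 y, cone (tos_order Z) y & p (y - z) < e) -> cone (tos_order Z) z.
Proof.
move=> zc; rewrite ((closure_id _).1 (@tos_closed _ Z)).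
move=> U /tos_nbhsP[p [e [pI e0 pU]]]; have [y y0 yz] := zc _ _ pI e0.
by exists y; split=> //; exact: pU.
Qed.

End OrderedStarSpaces.

Lemma admissible_cvg (R : realType) (Z : admissibleSpace R) (F : set_system Z) :
  ProperFilter F ->
  (forall p e, @incr_seminorm R Z p -> 0 < e ->
    exists2 A, F A & forall x y, A x -> A y -> p (x - y) < e) ->
  exists z : Z, forall p e, @incr_seminorm R Z p -> 0 < e ->
    F [set y | p (y - z) < e].
Proof.
move=> FF Fc; have [|z Fz] := adm_complete FF.
  move=> U /tos_nbhsP[p [e [pI e0 pU]]]; have [A FA Ae] := Fc _ _ pI e0.
  by exists A => // x y Ax Ay; apply: pU; rewrite /= subr0; exact: Ae.
by exists z; apply/tos_cvgP.
Qed.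

(** * Semi-inner products with values in an ordered star-space *)

(** The infimum over s of the right-hand side of the hypothesis is 2 A B, reached
    at s ^ 2 = B / A when A and B are positive; adding e to both A and B avoids
    the degenerate cases. Applied to the estimates for s x and y / s, it turns
    additive bounds into Schwarz and triangle inequalities. *)
Lemma le_double_mul (R : realType) (r A B : R) : 0 <= A -> 0 <= B ->
  (forall s, 0 < s -> r <= (s * A) ^+ 2 + (s^-1 * B) ^+ 2) -> r <= 2 * (A * B).
Proof.
move=> A0 B0 rs; apply/ler_addgt0Pr => d d0.
pose e := Num.min 1 (d / (2 * (A + B + 1))).
have e0 : 0 < e by rewrite lt_min ltr01 divr_gt0// mulr_gt0// ltr_wpDl// addr_ge0.
have e1 : e <= 1 by rewrite ge_min lexx.
have ed : e * (2 * (A + B + 1)) <= d.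
  by rewrite -ler_pdivlMr ?ge_min ?lexx ?orbT// mulr_gt0// ltr_wpDl// addr_ge0.
have Ae : 0 < A + e by exact: ltr_wpDl.
have Be : 0 < B + e by exact: ltr_wpDl.
pose s := Num.sqrt ((B + e) / (A + e)).
have s0 : 0 < s by rewrite sqrtr_gt0 divr_gt0.
have s2 : s ^+ 2 = (B + e) / (A + e) by rewrite sqr_sqrtr// ltW// divr_gt0.
apply: le_trans (rs _ s0) _.
have h1 : (s * A) ^+ 2 <= (A + e) * (B + e).
  apply: (@le_trans _ _ ((s * (A + e)) ^+ 2)).
    by rewrite ler_sqr ?nnegrE ?mulr_ge0 ?(ltW s0) ?(ltW Ae)// ler_pM2l// lerDl ltW.
  by rewrite exprMn s2 expr2 mulrA divfK ?gt_eqF// mulrC.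
have h2 : (s^-1 * B) ^+ 2 <= (A + e) * (B + e).
  have si : 0 < s^-1 by rewrite invr_gt0.
  apply: (@le_trans _ _ ((s^-1 * (B + e)) ^+ 2)).
    by rewrite ler_sqr ?nnegrE ?mulr_ge0 ?(ltW si) ?(ltW Be)// ler_pM2l// lerDl ltW.
  by rewrite exprMn exprVn s2 invf_div expr2 mulrA divfK ?gt_eqF.
apply: le_trans (lerD h1 h2) _.
have : e * e <= e by rewrite ger_pMl.
lra.
Qed.

(** Formal sums with a semi-inner product. The operations are constrained only
    through the form, by which vectors are compared, so lists with
    concatenation qualify without passing to a quotient. The completion is again
    an instance, which lets it reuse the inequalities below. *)
Record preVE (R : realType) (Z : topOrderedSpace R) := PreVE {
  pve_sort :> Type ;
  pve0 : pve_sort ;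
  pve_add : pve_sort -> pve_sort -> pve_sort ;
  pve_scale : R[i] -> pve_sort -> pve_sort ;
  form : pve_sort -> pve_sort -> Z ;
  formDr : forall x y z, form x (pve_add y z) = form x y + form x z ;
  formDl : forall x y z, form (pve_add x y) z = form x z + form y z ;
  formZr : forall a x y, form x (pve_scale a y) = a *: form x y ;
  formZl : forall a x y, form (pve_scale a x) y = a^*%R *: form x y ;
  form_cone : forall x, cone (tos_order Z) (form x x) }.

Section PreVE.
Variables (R : realType) (Z : topOrderedSpace R) (V : preVE Z).
Implicit Types (x y : V) (p q : Z -> R).

Definition pve_norm p x : R := Num.sqrt (p (form x x)).

Lemma pve_norm_ge0 p x : 0 <= pve_norm p x.
Proof. exact: sqrtr_ge0. Qed.

Lemma sqr_pve_norm p x : incr_seminorm p -> pve_norm p x ^+ 2 = p (form x x).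
Proof. by move=> [ps _ _]; rewrite sqr_sqrtr// seminorm_ge0. Qed.

Lemma form_add_sq x y : form (pve_add x y) (pve_add x y) =
  (form x x + form y y) + (form x y + form y x).
Proof. by rewrite formDl !formDr [X in _ + X]addrC addrACA. Qed.

Lemma form_scale_sq a x :
  form (pve_scale a x) (pve_scale a x) = (modulus a ^+ 2)%:C *: form x x.
Proof. by rewrite formZl formZr scalerA rmorphXn /= modulusE -normCKC. Qed.

Lemma pve_norm_scale p a x : incr_seminorm p ->
  pve_norm p (pve_scale a x) = modulus a * pve_norm p x.
Proof.
move=> [ps _ _]; rewrite /pve_norm form_scale_sq seminorm_scale//.
by rewrite modulus_real ?sqr_ge0// sqrtrM ?sqr_ge0// sqrtr_sqr ger0_norm// modulus_ge0.
Qed.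

(** Elements of the cone are selfadjoint, hence so are [x, y] + [y, x] and, on
    replacing y by i y, i ([x, y] - [y, x]). Positivity thus forces hermitian
    symmetry, with no continuity of the involution. *)
Lemma form_star x y : form x y = zstar (form y x).
Proof.
have sa (u : V) : zstar (form u u) = form u u.
  by apply: cone_selfadjoint; exact: form_cone.
have sD (u v : V) : zstar (form u v) + zstar (form v u) = form u v + form v u.
  have := sa (pve_add u v); rewrite form_add_sq !zstarD !sa.
  by move/addrI.
have h1 := sD x y; have := sD x (pve_scale 'i%C y).
rewrite formZl formZr !zstarZ.
rewrite conj_i conjN conj_i opprK.
move=> /(congr1 (fun z => 'i%C *: z)).
rewrite !scalerDr !scalerA !mulrN -!expr2 sqr_i opprK !scaleN1r !scale1r.
move=> h2; have h : 2%:R *: form x y = 2%:R *: zstar (form y x).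
  rewrite !scaler_nat !mulr2n.
  have -> : form x y + form x y = (form x y + form y x) - (- form x y + form y x).
    by rewrite opprD opprK addrACA subrr addr0.
  by rewrite -h1 -h2 opprB addrC addrA subrK.
by apply: scalerI h; rewrite pnatr_eq0.
Qed.

(** Positivity of the form at s x + y / s and at s x - y / s. *)
Lemma cross_dominated x y s : 0 < s ->
  let Q := (s ^+ 2)%:C *: form x x + ((s^-1) ^+ 2)%:C *: form y y in
  let S := form x y + form y x in
  cone (tos_order Z) (Q + S) /\ cone (tos_order Z) (Q - S).
Proof.
move=> s0 Q S; have s0' := lt0r_neq0 s0.
(* Both signs w = 1 and w = -1 at once. *)
have key (w : R[i]) : w^*%R = w -> modulus w = 1 ->
    cone (tos_order Z) (Q + w *: S).
  move=> wc w1; have := form_cone (pve_add (pve_scale s%:C x) (pve_scale (w * (s^-1)%:C) y)).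
  rewrite form_add_sq !form_scale_sq !formZl !formZr !scalerA.
  have -> : modulus (w * (s^-1)%:C) = s^-1.
    by rewrite /modulus normrM -[`|w|]modulusE w1 mul1r [LHS]modulus_real// invr_ge0 ltW.
  rewrite modulus_real ?ltW// conjM wc !conj_real [w * _]mulrC !mulrA -!rmorphM /=.
  have -> : (s^-1)%:C * w * s%:C = w.
    by rewrite mulrAC -rmorphM mulVf// rmorph1 mul1r.
  by rewrite mulfV// rmorph1 mul1r -scalerDr.
split; first by rewrite -[S]scale1r; apply: key; rewrite ?rmorph1// /modulus normr1.
by rewrite -scaleN1r; apply: key; rewrite ?conjN ?rmorph1// /modulus normrN1.
Qed.

Lemma pve_norm_sq_scale p x y s : incr_seminorm p -> 0 < s ->
  p ((s ^+ 2)%:C *: form x x + ((s^-1) ^+ 2)%:C *: form y y) <=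
  (s * pve_norm p x) ^+ 2 + (s^-1 * pve_norm p y) ^+ 2.
Proof.
move=> pI s0; have [ps _ _] := pI; apply: le_trans (ps.1 _ _) _.
by rewrite !seminormZ ?sqr_ge0// !exprMn !sqr_pve_norm.
Qed.

(** The cross terms [x, y] + [y, x] are dominated by s ^ 2 [x, x] + [y, y] / s ^ 2
    for every s; applying p and optimising over s gives exactly the cross term of
    the square of a sum. The Schwarz inequality with constant 4 would be too weak
    here. *)
Lemma pve_norm_triangle p x y : incr_seminorm p ->
  pve_norm p (pve_add x y) <= pve_norm p x + pve_norm p y.
Proof.
move=> pI; have [ps _ _] := pI.
rewrite -(@ler_pXn2r _ 2)// ?nnegrE ?addr_ge0 ?pve_norm_ge0// sqr_pve_norm//.
rewrite sqrrD.
have [A0 B0] := (pve_norm_ge0 p x, pve_norm_ge0 p y).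
suff : p (form (pve_add x y) (pve_add x y)) -
    (pve_norm p x ^+ 2 + pve_norm p y ^+ 2) <= 2 * (pve_norm p x * pve_norm p y).
  lra.
apply: le_double_mul => // s s0; rewrite lerBlDr.
have [_ QS] := cross_dominated x y s0; set Q := (_ *: _ + _) in QS.
have : zle (form (pve_add x y) (pve_add x y)) (Q + (form x x + form y y)).
  rewrite /zle /ordered_le form_add_sq.
  by rewrite [_ + (form x y + _)]addrC opprD addrA addrAC addrK.
move=> /(incr_seminorm_le pI (form_cone _))/le_trans; apply.
apply: le_trans (ps.1 _ _) _; apply: lerD; first exact: pve_norm_sq_scale.
by rewrite !sqr_pve_norm//; exact: ps.1.
Qed.

(** The symmetric part [x, y] + [y, x] is dominated from both sides, and the
    antisymmetric part is the symmetric part for i y up to the factor i. *)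
Lemma form_schwarz p x y : incr_seminorm p ->
  p (form x y) <= 4 * (pve_norm p x * pve_norm p y).
Proof.
move=> pI; have [ps _ _] := pI.
have cross (u v : V) : p (form u v + form v u) <= 4 * (pve_norm p u * pve_norm p v).
  have [A0 B0] := (pve_norm_ge0 p u, pve_norm_ge0 p v).
  suff : p (form u v + form v u) / 2 <= 2 * (pve_norm p u * pve_norm p v) by lra.
  apply: le_double_mul => // s s0; rewrite ler_pdivrMr// mulrC.
  have [QD QB] := cross_dominated u v s0.
  apply: le_trans (incr_seminorm_dominated pI QD QB) _.
  by rewrite ler_pM2l//; exact: pve_norm_sq_scale.
have i1 : modulus ('i%C : R[i]) = 1.
  by rewrite /modulus normc_def /= expr0n expr1n add0r sqrtr1.
have h1 := cross x y; have := cross x (pve_scale 'i%C y).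
rewrite formZl formZr conj_i scaleNr -scalerBr seminorm_scale// pve_norm_scale// i1 !mul1r.
move=> h2; have : p (2%:C *: form x y) <= p (form x y + form y x) + p (form x y - form y x).
  apply: le_trans (ps.1 _ _); rewrite addrACA subrr addr0.
  by rewrite rmorph_nat scaler_nat mulr2n.
by rewrite seminormZ//; lra.
Qed.

End PreVE.

(** * The completion of a formal semi-inner product space *)

Lemma le_mul_eps (R : realType) (r K : R) : 0 <= K ->
  (forall e, 0 < e -> r <= e * K) -> r <= 0.
Proof.
move=> K0 rK; rewrite leNgt; apply/negP => r0.
have K1 : 0 < K + 1 by exact: ltr_wpDl.
have /rK : 0 < r / (K + 1) by rewrite divr_gt0.
rewrite -mulrA [_^-1 * _]mulrC mulrA ler_pdivlMr// ler_pM2l//.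
by rewrite leNgt ltrDl ltr01.
Qed.

Section Completion.
Variables (R : realType) (Z : admissibleSpace R) (V : preVE Z).
Implicit Types (v w : V) (p q : Z -> R) (f g : V -> Z) (e : R).

(** The vector v approximates f within e, not only for p but for all increasing
    seminorms below p. The bound involves the norm of w for the same seminorm as
    the error, so an estimate for p alone says nothing about a smaller seminorm;
    with this definition, approximation for a sum of seminorms is approximation
    for each of them. *)
Definition approx p e f v : Prop :=
  forall q, incr_seminorm q -> (forall z, q z <= p z) ->
    forall w, q (f w - form w v) <= e * pve_norm q w.

Definition approximable f : Prop :=
  forall p e, incr_seminorm p -> 0 < e -> exists v, approx p e f v.

Definition approximable_pred : {pred V -> Z} := fun f => `[< approximable f >].

Lemma approx_le p q e d f v : approx p e f v ->
  (forall z, q z <= p z) -> e <= d -> approx q d f v.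
Proof.
move=> fv qp ed r rI rq w; apply: le_trans (fv _ rI _ w) _.
  by move=> z; exact: le_trans (rq z) (qp z).
by rewrite ler_wpM2r// pve_norm_ge0.
Qed.

Lemma approxD p e d f g v w : approx p e f v -> approx p d g w ->
  approx p (e + d) (f + g) (pve_add v w).
Proof.
move=> fv gw q qI qp u; have [qs _ _] := qI.
rewrite formDr opprD addrACA mulrDl; apply: le_trans (qs.1 _ _) _.
by rewrite lerD ?fv ?gw.
Qed.

Lemma approxZ p e (a : R[i]) f v : approx p e f v ->
  approx p (modulus a * e) (a *: f) (pve_scale a v).
Proof.
move=> fv q qI qp u; have [qs _ _] := qI.
rewrite formZr -[(a *: f) u]/(a *: f u) -scalerBr seminorm_scale// -mulrA.
by rewrite ler_wpM2l ?modulus_ge0// fv.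
Qed.

Lemma approx0 p e : 0 <= e -> approx p e 0 (pve_scale 0 (pve0 V)).
Proof.
move=> e0 q [qs _ _] qp u; rewrite formZr scale0r subr0 seminorm0//.
by rewrite mulr_ge0// pve_norm_ge0.
Qed.

Lemma approximable_submod_closed : submod_closed approximable_pred.
Proof.
split=> [|a f g /asboolP fP /asboolP gP]; apply/asboolP => p e pI e0.
  by exists (pve_scale 0 (pve0 V)); exact/approx0/ltW.
have e20 : 0 < e / 2 by rewrite divr_gt0.
have m0 : 0 < modulus a + 1 by rewrite ltr_wpDl// modulus_ge0.
have [v fv] := fP p (e / 2 / (modulus a + 1)) pI (divr_gt0 e20 m0).
have [w gw] := gP p (e / 2) pI e20.
exists (pve_add (pve_scale a v) w).
have /approx_le := approxD (approxZ a fv) gw; apply=> //.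
rewrite [leRHS]splitr lerD2r mulrA ler_pdivrMr// mulrC ler_pM2l//.
by rewrite lerDl.
Qed.

HB.instance Definition _ := GRing.isSubmodClosed.Build _ _ approximable_pred
  approximable_submod_closed.

Record completion := Completion {
  completion_fun :> V -> Z ;
  completion_subproof : approximable_pred completion_fun }.

HB.instance Definition _ := [isSub for completion_fun].
HB.instance Definition _ := [Choice of completion by <:].
HB.instance Definition _ := [SubChoice_isSubLmodule of completion by <:].

Implicit Types (h k : completion).

Lemma completionP h : approximable h.
Proof. exact/asboolP/(completion_subproof h). Qed.

Lemma completion_eq h k : (forall w, h w = k w) -> h = k.
Proof. by move=> hk; apply: val_inj; apply/funext. Qed.

Lemma completionD h k w : (h + k) w = h w + k w. Proof. by []. Qed.
Lemma completionZ (a : R[i]) h w : (a *: h) w = a *: h w. Proof. by []. Qed.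
Lemma completionB h k w : (h - k) w = h w - k w. Proof. by []. Qed.

Lemma embed_approximable v : approximable_pred (fun w => form w v).
Proof.
apply/asboolP => p e pI e0; exists v => q qI qp w; have [qs _ _] := qI.
by rewrite subrr seminorm0// mulr_ge0 ?pve_norm_ge0// ltW.
Qed.

Definition embed v : completion := Completion (embed_approximable v).

Lemma approx_embed p e v : 0 <= e -> approx p e (embed v) v.
Proof.
move=> e0 q qI qp w; have [qs _ _] := qI.
by rewrite subrr seminorm0// mulr_ge0 ?pve_norm_ge0.
Qed.

(** The arguments of h are conjugate linear as those of the functions
    [_, x] that approximate it. *)
Lemma completion_arg_linear h (a : R[i]) v w :
  h (pve_add (pve_scale a v) w) = a^*%R *: h v + h w.
Proof.
apply/eqP; rewrite -subr_eq0; apply/eqP; apply: tos_separated => p pI.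
have [ps _ _] := pI; set u := pve_add _ _.
pose C := pve_norm p u + modulus a * pve_norm p v + pve_norm p w.
have C0 : 0 <= C by rewrite !addr_ge0 ?mulr_ge0 ?modulus_ge0 ?pve_norm_ge0.
apply: (le_mul_eps C0) => e e0; have [x hx] := completionP h pI e0.
have hp y := hx p pI (fun=> lexx _) y.
have -> : h u - (a^*%R *: h v + h w) =
    (h u - form u x) - (a^*%R *: (h v - form v x) + (h w - form w x)).
  rewrite /u formDl formZl scalerBr [X in _ = _ - X]addrACA -opprD opprB addrA.
  by rewrite subrK.
rewrite !mulrDr; apply: le_trans (ps.1 _ _) _; rewrite -addrA lerD ?hp//.
rewrite seminormN//; apply: le_trans (ps.1 _ _) _; rewrite lerD ?hp//.
rewrite seminorm_scale// modulus_conj mulrCA.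
by rewrite ler_wpM2l ?modulus_ge0// hp.
Qed.

Definition difference v w : V := pve_add (pve_scale (-1) w) v.

Lemma completion_difference h v w : h (difference v w) = h v - h w.
Proof. by rewrite completion_arg_linear rmorphN1 scaleN1r addrC. Qed.

Lemma form_differencer u v w : form u (difference v w) = form u v - form u w.
Proof. by rewrite formDr formZr scaleN1r addrC. Qed.

Definition bounded_by p C f : Prop := forall w, p (f w) <= C * pve_norm p w.

Lemma completion_bounded h p : incr_seminorm p ->
  exists2 C, 0 <= C & bounded_by p C h.
Proof.
move=> pI; have [ps _ _] := pI; have [v hv] := completionP h pI ltr01.
exists (1 + 4 * pve_norm p v) => [|w].
  by rewrite addr_ge0// mulr_ge0// pve_norm_ge0.
rewrite -[h w](subrK (form w v)) mulrDl; apply: le_trans (ps.1 _ _) _.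
apply: lerD; first exact: hv.
by rewrite -mulrA [X in 4 * X]mulrC; exact: form_schwarz.
Qed.

(** Division by the norm in p [v, v] <= C p[v, v]^(1/2). *)
Lemma pve_norm_le p C v : 0 <= C -> incr_seminorm p ->
  p (form v v) <= C * pve_norm p v -> pve_norm p v <= C.
Proof.
move=> C0 pI; rewrite -sqr_pve_norm// expr2.
have := pve_norm_ge0 p v; rewrite le_eqVlt => /predU1P[<-//|n0].
by rewrite ler_pM2r.
Qed.

(** Approximations of the same h form a Cauchy family: the difference of their
    images is bounded by e + d relative to the norm, and this is evaluated at
    the difference itself. *)
Lemma approx_difference p e d h v w : incr_seminorm p -> 0 <= e -> 0 <= d ->
  approx p e h v -> approx p d h w -> pve_norm p (difference v w) <= e + d.
Proof.
move=> pI e0 d0 hv hw; have [ps _ _] := pI.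
apply: pve_norm_le => //; first exact: addr_ge0.
rewrite form_differencer mulrDl; set u := difference v w.
have -> : form u v - form u w = (h u - form u w) - (h u - form u v).
  by rewrite opprB [RHS]addrC addrA subrK.
apply: le_trans (ps.1 _ _) _; rewrite seminormN// addrC.
by apply: lerD; [exact: hv|exact: hw].
Qed.

Lemma approx_eval p e d C h k v w : incr_seminorm p -> 0 <= C -> 0 <= e -> 0 <= d ->
  bounded_by p C k -> approx p e h v -> approx p d h w ->
  p (k v - k w) <= C * (e + d).
Proof.
move=> pI C0 e0 d0 kC hv hw; rewrite -completion_difference.
apply: le_trans (kC _) _; rewrite ler_wpM2l//.
exact: (approx_difference pI e0 d0 hv hw).
Qed.

(** The value z is the limit of k v as v tends to h, with a rate. *)
Definition is_gram h k z : Prop :=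
  forall p e C v, incr_seminorm p -> 0 <= e -> 0 <= C -> bounded_by p C k ->
    approx p e h v -> p (z - k v) <= C * e.

(** The values k v, for v approximating h, form a Cauchy filter base in Z because
    k is bounded and approximations are close to each other. *)
Lemma gram_exists h k : exists z, is_gram h k z.
Proof.
pose F : set_system Z := [set U | exists p e, [/\ incr_seminorm p, 0 < e &
  forall v, approx p e h v -> U (k v)]].
have FF : ProperFilter F.
  split.
    by move=> [p [e [pI e0 F0]]]; have [v /F0] := completionP h pI e0.
  split.
  - by exists (fun=> 0), 1; split=> //; exact: incr_seminorm0.
  - move=> U W [p [e [pI e0 pU]]] [q [d [qI d0 qW]]].
    exists (p \+ q), (Num.min e d); split; first exact: incr_seminormD.
      by rewrite lt_min e0.
    have [[ps _ _] [qs _ _]] := (pI, qI).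
    move=> v hv; split; [apply: pU|apply: qW]; apply: (approx_le hv) => /=.
    + by move=> z; rewrite lerDl seminorm_ge0.
    + by rewrite ge_min lexx.
    + by move=> z; rewrite lerDr seminorm_ge0.
    + by rewrite ge_min lexx orbT.
  - move=> U W UW [p [e [pI e0 pU]]]; exists p, e; split=> // v /pU; exact: UW.
have [|z Fz] := admissible_cvg FF.
  move=> p e pI e0; have [C C0 kC] := completion_bounded k pI.
  have C1 : 0 < C + 1 by exact: ltr_wpDl.
  have d0 : 0 < e / 2 / (C + 1) by rewrite !divr_gt0.
  set d := e / 2 / (C + 1) in d0.
  exists [set k v | v in approx p d h]; first by exists p, d; split=> // v; exists v.
  move=> _ _ [v hv <-] [w hw <-].
  apply: le_lt_trans (approx_eval pI C0 (ltW d0) (ltW d0) kC hv hw) _.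
  have : (C + 1) * d = e / 2 by rewrite mulrC divfK// gt_eqF.
  lra.
exists z => p e C v pI e0 C0 kC hv; have [ps _ _] := pI.
(* Compare k v with k w for a w so close to h that k w is within d of z. *)
rewrite -subr_le0; apply: (@le_mul_eps _ _ (1 + C)); first exact: addr_ge0.
move=> d d0; have [q [d' [qI d'0 qz]]] := Fz _ _ pI d0.
have [qs _ _] := qI.
have [w hw] : exists w, approx (p \+ q) (Num.min d d') h w.
  by apply: completionP; [exact: incr_seminormD|rewrite lt_min d0].
have hwp : approx p d h w.
  by apply: (approx_le hw) => [x|]; rewrite ?ge_min ?lexx//= lerDl seminorm_ge0.
have /qz /= kwz : approx q d' h w.
  by apply: (approx_le hw) => [x|]; rewrite ?ge_min ?lexx ?orbT//= lerDr seminorm_ge0.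
have kwv := approx_eval pI C0 (ltW d0) e0 kC hwp hv.
rewrite lerBlDr; apply: le_trans (seminorm_triangle (k w) _ _ ps) _.
by rewrite seminormBC//; lra.
Qed.

Definition completion_gram h k : Z := xget 0 (is_gram h k).

Lemma completion_gramP h k : is_gram h k (completion_gram h k).
Proof. by have [z hz] := gram_exists h k; exact: (xgetI 0 hz). Qed.

(** Uniqueness of the limit, in a form that needs only one good approximation for
    each e, and approximation only up to a constant factor: sums, scalar
    multiples and images of approximations are of this kind. *)
Lemma completion_gramE h k z :
  (forall p, incr_seminorm p -> exists C, 0 <= C /\ forall e, 0 < e ->
    exists2 v, approx p (e * C) h v & p (z - k v) <= e * C) ->
  completion_gram h k = z.
Proof.
move=> hz; apply/eqP; rewrite -subr_eq0; apply/eqP; apply: tos_separated => p pI.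
have [ps _ _] := pI; have [C [C0 zC]] := hz _ pI.
have [D D0 kD] := completion_bounded k pI.
apply: (@le_mul_eps _ _ (C * D + C)); first by rewrite addr_ge0// mulr_ge0.
move=> e e0; have [v hv zv] := zC _ e0.
apply: le_trans (seminorm_triangle (k v) _ _ ps) _.
rewrite mulrDr lerD//; last by rewrite seminormBC.
rewrite mulrA mulrC; apply: (completion_gramP pI _ D0 kD hv).
by rewrite mulr_ge0// ltW.
Qed.

Lemma completion_gram_embed v h : completion_gram (embed v) h = h v.
Proof.
apply: completion_gramE => p [ps _ _]; exists 0; split=> // e e0.
by exists v; [apply: approx_embed; rewrite mulr0|rewrite subrr seminorm0// mulr0].
Qed.

Lemma completion_gramDr h k l :
  completion_gram h (k + l) = completion_gram h k + completion_gram h l.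
Proof.
apply: completion_gramE => p pI; have [ps _ _] := pI.
have [C C0 kC] := completion_bounded k pI.
have [D D0 lD] := completion_bounded l pI.
exists (1 + C + D); split; first by rewrite !addr_ge0.
move=> e e0; have [v hv] := completionP h pI e0; exists v.
  by apply: (approx_le hv) => //; rewrite ler_peMr ?(ltW e0)// -addrA lerDl addr_ge0.
rewrite completionD opprD addrACA; apply: le_trans (ps.1 _ _) _.
have := completion_gramP pI (ltW e0) C0 kC hv.
have := completion_gramP pI (ltW e0) D0 lD hv.
lra.
Qed.

Lemma completion_gramZr (a : R[i]) h k :
  completion_gram h (a *: k) = a *: completion_gram h k.
Proof.
apply: completion_gramE => p pI; have [ps _ _] := pI.
have [C C0 kC] := completion_bounded k pI.
have m0 := modulus_ge0 a.
exists (1 + modulus a * C); split; first by rewrite !addr_ge0// mulr_ge0.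
move=> e e0; have [v hv] := completionP h pI e0; exists v.
  by apply: (approx_le hv) => //; rewrite ler_peMr ?(ltW e0)// lerDl mulr_ge0.
rewrite completionZ -scalerBr seminorm_scale// mulrDr mulr1.
have := completion_gramP pI (ltW e0) C0 kC hv.
move=> /(ler_wpM2l m0) /le_trans; apply.
by rewrite [e * (_ * _)]mulrCA [e * C]mulrC lerDr ltW.
Qed.

(** Approximations of the summands give one of the sum, at which l is evaluated by
    conjugate linearity in its argument. *)
Lemma completion_gram_linearl (a : R[i]) h k l :
  completion_gram (a *: h + k) l =
  a^*%R *: completion_gram h l + completion_gram k l.
Proof.
apply: completion_gramE => p pI; have [ps _ _] := pI.
have [C C0 lC] := completion_bounded l pI.
have m0 := modulus_ge0 a; have mC := mulr_ge0 m0 C0.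
exists ((modulus a + 1) * (C + 1)); split; first by rewrite mulr_ge0// ltW// ltr_wpDl.
move=> e e0; have [v hv] := completionP h pI e0.
have [w kw] := completionP k pI e0; exists (pve_add (pve_scale a v) w).
  have hk : approx p (modulus a * e + e) (completion_fun (a *: h + k))
      (pve_add (pve_scale a v) w).
    exact: approxD (approxZ a hv) kw.
  apply: (approx_le hk) => //.
  by have := mulr_ge0 (ltW e0) C0; have := mulr_ge0 (ltW e0) mC; lra.
rewrite completion_arg_linear opprD addrACA -scalerBr.
apply: le_trans (ps.1 _ _) _; rewrite seminorm_scale// modulus_conj.
have := completion_gramP pI (ltW e0) C0 lC kw.
have := completion_gramP pI (ltW e0) C0 lC hv => /(ler_wpM2l m0).
by have := mulr_ge0 (ltW e0) m0; lra.
Qed.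

(** Diagonal values of the form converge to the diagonal of the inner product;
    positivity and domination are transported to the completion along this. *)
Lemma completion_gram_approx h p e : incr_seminorm p -> 0 < e ->
  exists2 d, 0 < d & forall v, approx p d h v ->
    p (completion_gram h h - form v v) <= e.
Proof.
move=> pI e0; have [ps _ _] := pI; have [C C0 hC] := completion_bounded h pI.
pose d := Num.min 1 (e / (2 * C + 1)).
have C1 : 0 < 2 * C + 1 by rewrite ltr_wpDl// mulr_ge0.
have d0 : 0 < d by rewrite lt_min ltr01 divr_gt0.
have d1 : d <= 1 by rewrite ge_min lexx.
have dC : d * (2 * C + 1) <= e.
  by rewrite -ler_pdivlMr// ge_min lexx orbT.
exists d => // v hv.
have hvv : p (h v - form v v) <= d * pve_norm p v by exact: hv.
have nv : pve_norm p v <= C + d.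
  apply: pve_norm_le => //; first by rewrite addr_ge0// ltW.
  have := hC v; have := seminorm_triangle (h v) (form v v) 0 ps.
  by rewrite !subr0 [p (_ - h v)]seminormBC// mulrDl; lra.
have hg := completion_gramP pI (ltW d0) C0 hC hv.
apply: le_trans (seminorm_triangle (h v) _ _ ps) _.
have := ler_wpM2l (ltW d0) nv; have := ler_wpM2l (ltW d0) d1.
lra.
Qed.

Lemma completion_gram_cone h : cone (tos_order Z) (completion_gram h h).
Proof.
apply: cone_limit => p e pI e0; have [ps _ _] := pI.
have e20 : 0 < e / 2 by rewrite divr_gt0.
have [d d0 hd] := completion_gram_approx h pI e20.
have [v hv] := completionP h pI d0; exists (form v v); first exact: form_cone.
by rewrite seminormBC// (le_lt_trans (hd _ hv))// ltr_pdivrMr// ltr_pMr// ltr1n.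
Qed.

Lemma completion_gramDl h k l :
  completion_gram (h + k) l = completion_gram h l + completion_gram k l.
Proof. by rewrite -[h in LHS]scale1r completion_gram_linearl rmorph1 scale1r. Qed.

Lemma completion_gramZl (a : R[i]) h k :
  completion_gram (a *: h) k = a^*%R *: completion_gram h k.
Proof.
have g0 : completion_gram 0 k = 0.
  by apply: (addIr (completion_gram 0 k)); rewrite -completion_gramDl !add0r.
by rewrite -[a *: h]addr0 completion_gram_linearl g0 addr0.
Qed.

Definition completion_preVE : preVE Z := @PreVE R Z completion 0 +%R *:%R
  completion_gram completion_gramDr completion_gramDl
  completion_gramZr completion_gramZl completion_gram_cone.

Definition completion_norm p h : R := @pve_norm R Z completion_preVE p h.

Lemma completion_norm_seminorm p : incr_seminorm p -> seminorm (completion_norm p).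
Proof.
move=> pI; split=> [h k|a h]; first exact: (@pve_norm_triangle _ _ completion_preVE).
have := @pve_norm_scale _ _ completion_preVE p a h pI.
by rewrite -modulusE -rmorphM /= => <-.
Qed.

Lemma completion_schwarz p h k : incr_seminorm p ->
  p (completion_gram h k) <= 4 * (completion_norm p h * completion_norm p k).
Proof. exact: (@form_schwarz _ _ completion_preVE). Qed.

Lemma completion_norm_embed p v : completion_norm p (embed v) = pve_norm p v.
Proof. by rewrite /completion_norm /pve_norm /= completion_gram_embed. Qed.

Lemma completion_norm_le p q h : (forall z, q z <= p z) ->
  completion_norm q h <= completion_norm p h.
Proof. by move=> qp; apply: ler_wsqrtr. Qed.

Lemma completion_eval_le p h v : incr_seminorm p ->
  p (h v) <= 4 * completion_norm p h * pve_norm p v.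
Proof.
move=> pI; rewrite -completion_norm_embed -(completion_gram_embed v h).
by rewrite -mulrA [X in 4 * X]mulrC; exact: completion_schwarz.
Qed.

(** A function bounded by e is within e of the zero vector, so its inner product
    with itself is within e ^ 2 of its value at the zero vector, which is 0.
    With the Schwarz inequality this shows that the operator bound of h and its
    norm are equivalent. *)
Lemma completion_norm_bounded p e h : incr_seminorm p -> 0 <= e ->
  (forall q, incr_seminorm q -> (forall z, q z <= p z) -> bounded_by q e h) ->
  completion_norm p h <= e.
Proof.
move=> pI e0 he; have hp := he p pI (fun=> lexx _).
have h0 : approx p e h (pve_scale 0 (pve0 V)).
  by move=> q qI qp w; rewrite formZr scale0r subr0; exact: he.
have [ps _ _] := pI; have := completion_gramP pI e0 e0 hp h0.
have -> : h (pve_scale 0 (pve0 V)) = 0.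
  apply: tos_separated => q qI; apply: le_trans (completion_eval_le _ _ qI) _.
  by rewrite pve_norm_scale// /modulus normr0 mul0r mulr0.
rewrite subr0 => hh; rewrite -(@ler_pXn2r _ 2)// ?nnegrE ?sqrtr_ge0//.
by rewrite sqr_pve_norm.
Qed.

Lemma completion_norm_approx p e h v : incr_seminorm p -> 0 <= e ->
  approx p e h v -> completion_norm p (h - embed v) <= e.
Proof. by move=> pI e0 hv; apply: completion_norm_bounded. Qed.

Lemma completion_gram_eq0 h : completion_gram h h = 0 <-> h = 0.
Proof.
split=> [hh|->]; last first.
  by apply: (addIr (completion_gram 0 0)); rewrite -completion_gramDl !add0r.
apply: completion_eq => w; apply: tos_separated => p pI; have [ps _ _] := pI.
apply: le_trans (completion_eval_le _ _ pI) _.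
by rewrite /completion_norm /pve_norm /= hh seminorm0// sqrtr0 mulr0 mul0r.
Qed.

Lemma completion_seminormP (n : completion -> R) :
  [set completion_norm p | p in @incr_seminorm R Z] n -> seminorm n.
Proof. by move=> [p pI <-]; exact: completion_norm_seminorm. Qed.

Definition completion_tvs : tvsType R[i] :=
  seminormed (SeminormFamily completion_seminormP).

Lemma completion_gram_ge0 h : zle 0 (completion_gram h h).
Proof. by rewrite zle0; exact: completion_gram_cone. Qed.

Lemma completion_gram_star h k :
  completion_gram h k = zstar (completion_gram k h).
Proof. exact: (@form_star _ _ completion_preVE). Qed.

Lemma completion_gram_linear (a : R[i]) h k l :
  completion_gram h (a *: k + l) =
  a *: completion_gram h k + completion_gram h l.
Proof. by rewrite completion_gramDr completion_gramZr. Qed.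

Definition completion_VE : VEspace Z := @VESpace R Z completion_tvs
  completion_gram completion_gram_ge0 completion_gram_eq0 completion_gram_star
  completion_gram_linear (@seminormed_topology _ _ _).

Lemma completion_nbhsP (h : completion_VE) U : nbhs h U <->
  exists p e, [/\ incr_seminorm p, 0 < e &
    [set k | completion_norm p (k - h) < e] `<=` U].
Proof.
split; last first.
  move=> [p [e [pI e0 pU]]]; exists 1%N, (fun=> completion_norm p), e.
  by split=> [_||k /(_ ord0)]; [exists p|by []|exact: pU].
move=> [n [N [e [NP e0 NU]]]].
(* The topology comes from finitely many seminorms, all below a single one. *)
have [p pI Np] : exists2 p, incr_seminorm p & forall i k, N i k <= completion_norm p k.
  pose r i := projT1 (cid2 (NP i)).
  have rI i : incr_seminorm (r i) by rewrite /r; case: cid2.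
  have rN i : completion_norm (r i) = N i by rewrite /r; case: cid2.
  have [p pI rp] := incr_seminorm_max rI; exists p => // i k.
  by rewrite -rN; apply: completion_norm_le.
exists p, e; split=> // k hk; apply: NU => i; exact: le_lt_trans (Np _ _) hk.
Qed.

(** A Cauchy filter on the completion converges pointwise, because evaluation at w
    is continuous; the Cauchy estimate passes to the pointwise limit f uniformly
    in w, so f is again approximable and is the limit in norm. *)
Lemma completion_complete : tvs_complete completion_VE.
Proof.
move=> F FF Fc.
have Fp p e : incr_seminorm p -> 0 < e -> exists2 A, F A &
    forall h k : completion, A h -> A k -> completion_norm p (h - k) < e.
  move=> pI e0; apply: (Fc [set k | completion_norm p k < e]).
  by apply/completion_nbhsP; exists p, e; split=> // k /=; rewrite subr0.
have Fw w : exists z : Z, forall p e, incr_seminorm p -> 0 < e ->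
    F [set h : completion | p (h w - z) < e].
  pose Fz : set_system Z := [set U | F [set h : completion | U (h w)]].
  have FzF : ProperFilter Fz := fmap_proper_filter (fun h : completion => h w) FF.
  have [|z Fz_z] := admissible_cvg FzF; last by exists z.
  move=> p e pI e0; pose D := 4 * pve_norm p w + 1.
  have D0 : 0 < D by rewrite ltr_wpDl// mulr_ge0// pve_norm_ge0.
  have [A FA Ae] := Fp p (e / D) pI (divr_gt0 e0 D0).
  exists [set z | exists2 h : completion, A h & h w = z].
    change (F [set h : completion | exists2 k : completion, A k & k w = h w]).
    by apply: filterS FA => h Ah; exists h.
  move=> _ _ [h Ah <-] [k Ak <-]; rewrite -completionB.
  apply: le_lt_trans (completion_eval_le _ _ pI) _.
  have := Ae _ _ Ah Ak; rewrite ltr_pdivlMr//; apply: le_lt_trans.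
  by rewrite mulrAC mulrC ler_wpM2l ?sqrtr_ge0// lerDl.
have [f ff] := choice Fw.
have close p e : incr_seminorm p -> 0 < e -> exists2 A, F A &
    forall h : completion, A h -> forall q, incr_seminorm q ->
    (forall z, q z <= p z) -> forall w, q (h w - f w) <= e * pve_norm q w.
  move=> pI e0; have e4 : 0 < e / 4 by rewrite divr_gt0.
  have [A FA Ae] := Fp p (e / 4) pI e4.
  exists A => // h Ah q qI qp w; have [qs _ _] := qI.
  apply/ler_addgt0Pr => d d0.
  have [k [Ak kf]] := filter_ex (filterI FA (ff w q d qI d0)).
  apply: le_trans (seminorm_triangle (k w) _ _ qs) _.
  apply: lerD; last exact: ltW.
  rewrite -completionB; apply: le_trans (completion_eval_le _ _ qI) _.
  rewrite ler_wpM2r ?pve_norm_ge0// mulrC -ler_pdivlMr//.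
  exact: le_trans (completion_norm_le _ qp) (ltW (Ae _ _ Ah Ak)).
have fP : approximable_pred f.
  apply/asboolP => p e pI e0; have e20 : 0 < e / 2 by rewrite divr_gt0.
  have [A FA Af] := close p (e / 2) pI e20; have [h Ah] := filter_ex FA.
  have [v hv] := completionP h pI e20; exists v => q qI qp w.
  have [qs _ _] := qI; rewrite [e]splitr mulrDl.
  apply: le_trans (seminorm_triangle (h w) _ _ qs) _; apply: lerD; last exact: hv.
  by rewrite seminormBC//; exact: Af.
exists (Completion fP) => U /completion_nbhsP[p [e [pI e0 pU]]].
have e20 : 0 < e / 2 by rewrite divr_gt0.
have [A FA Af] := close p (e / 2) pI e20.
apply: filterS FA => h Ah; apply: pU => /=.
apply: (@le_lt_trans _ _ (e / 2)); last by rewrite ltr_pdivrMr// ltr_pMr// ltr1n.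
apply: completion_norm_bounded => // [|q qI qp w]; first exact: ltW.
exact: Af.
Qed.

Definition completion_VH : VHspace Z := VHSpace completion_complete.

End Completion.

(** * Extension of operators to the completion *)

Lemma dominated_pve_norm (R : realType) (Z : topOrderedSpace R) (V : preVE Z)
    (p : Z -> R) (b : R) (x y : V) : incr_seminorm p -> 0 <= b ->
  zle (form y y) ((b ^+ 2)%:C *: form x x) -> pve_norm p y <= b * pve_norm p x.
Proof.
move=> pI b0 yx; have [ps _ _] := pI.
rewrite -(@ler_pXn2r _ 2)// ?nnegrE ?mulr_ge0 ?pve_norm_ge0//.
rewrite exprMn !sqr_pve_norm// -seminormZ ?sqr_ge0//.
exact: incr_seminorm_le (form_cone _) yx.
Qed.

(** A bounded map on formal sums with a bounded formal adjoint. Linearity is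
    automatic for the extension, which is composition with the adjoint. *)
Record formalOperator (R : realType) (Z : topOrderedSpace R) (V : preVE Z) :=
  FormalOperator {
    fop :> V -> V ;
    fop_adj : V -> V ;
    fop_bound : R ;
    fop_adj_bound : R ;
    fop_bound_ge0 : 0 <= fop_bound ;
    fop_adj_bound_ge0 : 0 <= fop_adj_bound ;
    fop_adjP : forall w v, form (fop_adj w) v = form w (fop v) ;
    fop_dominated : forall v,
      zle (form (fop v) (fop v)) ((fop_bound ^+ 2)%:C *: form v v) ;
    fop_adj_dominated : forall v,
      zle (form (fop_adj v) (fop_adj v)) ((fop_adj_bound ^+ 2)%:C *: form v v) }.

Section Extension.
Variables (R : realType) (Z : admissibleSpace R) (V : preVE Z).
Implicit Types (v w : V) (p : Z -> R) (h k : completion V).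
Implicit Types phi psi : formalOperator V.

Lemma fop_swapP phi w v : form (phi w) v = form w (fop_adj phi v).
Proof. by rewrite form_star -fop_adjP -form_star. Qed.

Definition fop_swap phi : formalOperator V := FormalOperator
  (fop_adj_bound_ge0 phi) (fop_bound_ge0 phi) (fop_swapP phi)
  (fop_adj_dominated phi) (fop_dominated phi).

(** Here boundedness of the adjoint is used: f is evaluated at adjoint images,
    whose norms must be controlled. *)
Lemma approx_extension phi p e (f : V -> Z) v : 0 <= e -> approx p e f v ->
  approx p (fop_adj_bound phi * e) (f \o fop_adj phi) (phi v).
Proof.
move=> e0 fv q qI qp w; rewrite /= -fop_adjP; apply: le_trans (fv q qI qp _) _.
rewrite [leRHS]mulrAC [leRHS]mulrC ler_wpM2l//.
exact: (dominated_pve_norm qI (fop_adj_bound_ge0 phi) (fop_adj_dominated phi w)).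
Qed.

Lemma extension_approximable phi h :
  approximable_pred (h \o fop_adj phi : V -> Z).
Proof.
apply/asboolP => p e pI e0; set b := fop_adj_bound phi.
have b0 : 0 <= b := fop_adj_bound_ge0 phi.
have b1 : 0 < b + 1 by rewrite ltr_wpDl.
have d0 : 0 < e / (b + 1) by rewrite divr_gt0.
have [v hv] := completionP h pI d0; exists (phi v).
apply: (approx_le (approx_extension phi (ltW d0) hv)) => //.
by rewrite mulrA ler_pdivrMr// mulrC ler_pM2l// lerDl.
Qed.

Definition extension phi (h : completion_VE V) : completion_VE V :=
  Completion (extension_approximable phi h).

Lemma extension_linear phi : linear (extension phi).
Proof. by move=> a h k; exact: completion_eq. Qed.

HB.instance Definition _ phi := GRing.isLinear.Build R[i] (completion_VE V)
  (completion_VE V) *:%R (extension phi) (extension_linear phi).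

(** If v approximates h then phi v approximates its extension, and k (phi v) is
    also the value at v of the extension of k along psi, so both sides are the
    limit of the same values. *)
Lemma extension_adjoint phi psi h k : (forall v, fop_adj psi v = phi v) ->
  completion_gram (extension phi h) k = completion_gram h (extension psi k).
Proof.
move=> psi_phi; apply: completion_gramE => p pI.
have [C C0 kC] := completion_bounded (extension psi k) pI.
have b0 := fop_adj_bound_ge0 phi.
exists (fop_adj_bound phi + C); split; first exact: addr_ge0.
move=> e e0; have [v hv] := completionP h pI e0; exists (phi v).
  apply: (approx_le (approx_extension phi (ltW e0) hv)) => //.
  by rewrite mulrC ler_pM2l// lerDl.
have := completion_gramP pI (ltW e0) C0 kC hv.
rewrite /= psi_phi => /le_trans; apply.
by rewrite mulrC ler_pM2l// lerDr.
Qed.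

Lemma extension_dominated phi h :
  zle (completion_gram (extension phi h) (extension phi h))
      ((fop_bound phi ^+ 2)%:C *: completion_gram h h).
Proof.
apply: cone_limit => p e pI e0; have [ps _ _] := pI.
set c := fop_bound phi; have c0 : 0 <= c := fop_bound_ge0 phi.
set b := fop_adj_bound phi; have b0 : 0 <= b := fop_adj_bound_ge0 phi.
have c1 : 0 < c ^+ 2 + 1 by rewrite ltr_wpDl// sqr_ge0.
have b1 : 0 < b + 1 by rewrite ltr_wpDl.
have e30 : 0 < e / 3 by rewrite divr_gt0.
have [d d0 hd] := completion_gram_approx h pI (divr_gt0 e30 c1).
have [d' d'0 hd'] := completion_gram_approx (extension phi h) pI e30.
have d1 : 0 < Num.min d (d' / (b + 1)) by rewrite lt_min d0 divr_gt0.
have [v hv] := completionP h pI d1.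
exists ((c ^+ 2)%:C *: form v v - form (phi v) (phi v)).
  exact: fop_dominated.
have hd1 : p (completion_gram h h - form v v) <= e / 3 / (c ^+ 2 + 1).
  by apply: hd; apply: (approx_le hv) => //; rewrite ge_min lexx.
have hd2 : p (completion_gram (extension phi h) (extension phi h) -
    form (phi v) (phi v)) <= e / 3.
  apply: hd'; apply: (approx_le (approx_extension phi (ltW d1) hv)) => //.
  rewrite -/b; apply: (@le_trans _ _ (b * (d' / (b + 1)))).
    by rewrite ler_wpM2l// ge_min lexx orbT.
  by rewrite mulrA ler_pdivrMr// mulrC ler_pM2l// lerDl.
set x := completion_gram h h in hd1 *; set y := completion_gram _ _ in hd2 *.
have -> : (c ^+ 2)%:C *: form v v - form (phi v) (phi v) -
    ((c ^+ 2)%:C *: x - y) =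
    (y - form (phi v) (phi v)) - (c ^+ 2)%:C *: (x - form v v).
  rewrite scalerBr !opprB [RHS]addrC -!addrA; congr (_ + _).
  by rewrite addrCA [RHS]addrCA; congr (_ + _); exact: addrC.
apply: le_lt_trans (ps.1 _ _) _; rewrite seminormN// seminormZ ?sqr_ge0//.
have : c ^+ 2 * p (x - form v v) <= e / 3.
  have : (c ^+ 2 + 1) * p (x - form v v) <= e / 3 by rewrite mulrC -ler_pdivlMr.
  by have := seminorm_ge0 (x - form v v) ps; lra.
lra.
Qed.

Lemma extension_norm phi p h : incr_seminorm p ->
  completion_norm p (extension phi h) <= fop_bound phi * completion_norm p h.
Proof.
move=> pI; apply: (@dominated_pve_norm _ _ (completion_preVE V)) => //.
  exact: fop_bound_ge0.
exact: extension_dominated.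
Qed.

Lemma extension_bounded phi : bounded_operator (extension phi : {linear _ -> _}).
Proof. by exists (fop_bound phi); [exact: fop_bound_ge0|exact: extension_dominated]. Qed.

Lemma extension_adjointable phi : exists S' : {linear completion_VE V -> completion_VE V},
  is_adjoint (extension phi : {linear _ -> _}) S'.
Proof.
by exists (extension (fop_swap phi) : {linear _ -> _}) => h k; exact: extension_adjoint.
Qed.

Definition extension_BA phi : boundedAdjointable (completion_VE V) :=
  BoundedAdjointable (extension_bounded phi) (extension_adjointable phi).

(** The error depends on phi only through its bound, so it is uniform along a
    family of operators with bounded constants. *)
Lemma extension_gram_approx phi p d h k v w : incr_seminorm p -> 0 <= d ->
  approx p d h v -> approx p d k w ->
  p (completion_gram h (extension phi k) - form v (phi w)) <=
  4 * fop_bound phi * d * (completion_norm p h + completion_norm p k + d).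
Proof.
move=> pI d0 hv kw; have [ps _ _] := pI.
set b := fop_bound phi; have b0 : 0 <= b := fop_bound_ge0 phi.
have E u : form v (phi u) = completion_gram (embed v) (extension phi (embed u)).
  by rewrite completion_gram_embed /= fop_adjP.
have -> : completion_gram h (extension phi k) - form v (phi w) =
    completion_gram (h - embed v) (extension phi k) +
    completion_gram (embed v) (extension phi (k - embed w)).
  rewrite E [extension phi (k - _)]raddfB /=.
  rewrite -[- embed v]scaleN1r -[- extension phi _]scaleN1r.
  rewrite completion_gramDl completion_gramDr completion_gramZl completion_gramZr.
  by rewrite rmorphN1 !scaleN1r addrA subrK.
have nv := completion_norm_approx pI d0 hv.
have nw := completion_norm_approx pI d0 kw.
have nw' := extension_norm phi (k - embed w) pI.
have nk := extension_norm phi k pI.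
have nn : completion_norm p (embed v) <= completion_norm p h + d.
  have [nD _] := completion_norm_seminorm V pI.
  have := nD h (embed v - h); rewrite addrC subrK.
  by rewrite seminormBC; [lra|exact: completion_norm_seminorm].
apply: le_trans (ps.1 _ _) _.
apply: le_trans (lerD (completion_schwarz _ _ pI) (completion_schwarz _ _ pI)) _.
have h0 : 0 <= completion_norm p h by exact: sqrtr_ge0.
have : completion_norm p (h - embed v) * completion_norm p (extension phi k) <=
    d * (b * completion_norm p k).
  by apply: ler_pM; rewrite ?sqrtr_ge0.
have : completion_norm p (embed v) * completion_norm p (extension phi (k - embed w)) <=
    (completion_norm p h + d) * (b * d).
  apply: ler_pM; rewrite ?sqrtr_ge0//; apply: le_trans nw' _.
  by rewrite ler_wpM2l.
lra.
Qed.

End Extension.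

(** * The dilation of a positive semidefinite map *)

Lemma tails_filter (L : Type) (le : L -> L -> Prop) :
  directed le -> Filter (tails le).
Proof.
move=> [[l0] le_refl le_trans le_dir]; apply: filter_from_filter.
  by exists l0.
move=> i j _ _; have [k [ik jk]] := le_dir i j.
by exists k => // m km; split; [exact: le_trans ik km|exact: le_trans jk km].
Qed.

Lemma cvg_seminorm_sum (R : realType) (Z : topOrderedSpace R) (L I : Type)
    (F : set_system L) (r : seq I) (f : L -> I -> Z) (g : I -> Z) (p : Z -> R) :
  Filter F -> incr_seminorm p ->
  (forall i e, 0 < e -> F [set l | p (f l i - g i) < e]) ->
  forall e, 0 < e -> F [set l | p (\sum_(i <- r) f l i - \sum_(i <- r) g i) < e].
Proof.
move=> FF pI fg; have [ps _ _] := pI; elim: r => [|i r IHr] e e0.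
  by apply: filterS filterT => l _ /=; rewrite !big_nil subrr seminorm0.
have e20 : 0 < e / 2 by rewrite divr_gt0.
apply: filterS (filterI (fg i _ e20) (IHr _ e20)) => l [/= h1 h2].
rewrite !big_cons opprD addrACA [e]splitr.
by apply: le_lt_trans (ps.1 _ _) _; exact: ltrD.
Qed.

Lemma conjDualZ (R : realType) (X Z : lmodType R[i]) (f : conjDual X Z)
    (a : R[i]) x :
  f (a *: x) = a^*%R *: f x.
Proof.
have f0 : f 0 = 0.
  have := conjDualP f 1 0 0; rewrite rmorph1 !scale1r addr0 => f0.
  by apply: (addIr (f 0)); rewrite add0r -f0.
by rewrite -[a *: x]addr0 conjDualP f0 addr0.
Qed.

Lemma nbhs0_translate (R : realType) (X : topologicalLmodType R[i]) (x : X)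
    (U : set X) :
  nbhs 0 U -> nbhs x [set y | U (y - x)].
Proof.
move=> /(nbhsT_subproof (@add_continuous X) x); apply: filterS => _ [y Uy <-].
by rewrite /= addrC addKr.
Qed.

Section Dilation.
Variables (R : realType) (Z : admissibleSpace R) (G : starMonoidType).
Variables (X : topologicalLmodType R[i]) (T : G -> {linear X -> conjDual X Z}).
Hypothesis T_psd : forall (n : nat) (s : 'I_n -> G) (x : 'I_n -> X),
  zle 0 (\sum_(i < n) \sum_(j < n) T ((s i)^* * s j)%g (x j) (x i)).
Variable c : G -> R.
Hypothesis c_ge0 : forall u : G, 0 <= c u.
Hypothesis T_bounded : forall (u : G) (n : nat) (s : 'I_n -> G) (x : 'I_n -> X),
  zle (\sum_(i < n) \sum_(j < n) T ((s i)^* * u^* * u * s j)%g (x j) (x i))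
      ((c u ^+ 2)%:C *:
        (\sum_(i < n) \sum_(j < n) T ((s i)^* * s j)%g (x j) (x i))).

Definition kernel (a b : G * X) : Z := T (a.1^* * b.1)%g b.2 a.2.

Definition fsum : Type := seq (G * X).

Definition fsum_scale (a : R[i]) (v : fsum) : fsum :=
  [seq (b.1, a *: b.2) | b <- v].

Definition fsum_form (w v : fsum) : Z :=
  \sum_(a <- w) \sum_(b <- v) kernel a b.

Lemma fsum_formDr w v v' :
  fsum_form w (v ++ v') = fsum_form w v + fsum_form w v'.
Proof. by rewrite -big_split; apply: eq_bigr => a _; rewrite big_cat. Qed.

Lemma fsum_formDl w w' v :
  fsum_form (w ++ w') v = fsum_form w v + fsum_form w' v.
Proof. exact: big_cat. Qed.

Lemma fsum_formZr a w v : fsum_form w (fsum_scale a v) = a *: fsum_form w v.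
Proof.
rewrite scaler_sumr; apply: eq_bigr => b _; rewrite big_map scaler_sumr.
by apply: eq_bigr => d _; rewrite /kernel /= linearZ.
Qed.

Lemma fsum_formZl a w v : fsum_form (fsum_scale a w) v = a^*%R *: fsum_form w v.
Proof.
rewrite /fsum_form big_map scaler_sumr; apply: eq_bigr => b _.
rewrite scaler_sumr; apply: eq_bigr => d _.
by rewrite /kernel /= conjDualZ.
Qed.

Lemma fsum_formE w v : fsum_form w v =
  \sum_(i < size w) \sum_(j < size v)
    kernel (tnth (in_tuple w) i) (tnth (in_tuple v) j).
Proof. by rewrite /fsum_form big_tnth; apply: eq_bigr => i _; rewrite big_tnth. Qed.

Lemma fsum_form_cone v : cone (tos_order Z) (fsum_form v v).
Proof.
rewrite -zle0 fsum_formE.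
exact: (T_psd (fun i => (tnth (in_tuple v) i).1) (fun i => (tnth (in_tuple v) i).2)).
Qed.

Definition fsum_preVE : preVE Z := @PreVE R Z fsum [::] cat fsum_scale
  fsum_form fsum_formDr fsum_formDl fsum_formZr fsum_formZl fsum_form_cone.

Definition fsum_act (u : G) (v : fsum) : fsum := [seq ((u * b.1)%g, b.2) | b <- v].

(** The involution of G reverses products, so the star of (star u) a, times b, is
    (star a) (u b). *)
Lemma fsum_act_adj u w v : fsum_form (fsum_act u^*%g w) v = fsum_form w (fsum_act u v).
Proof.
rewrite /fsum_form big_map; apply: eq_bigr => a _; rewrite big_map.
by apply: eq_bigr => b _; rewrite /kernel /= invgM invgK mulgA.
Qed.

Lemma fsum_act_dominated u v : zle (fsum_form (fsum_act u v) (fsum_act u v))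
  ((c u ^+ 2)%:C *: fsum_form v v).
Proof.
have -> : fsum_form (fsum_act u v) (fsum_act u v) =
    \sum_(i < size v) \sum_(j < size v)
      T ((tnth (in_tuple v) i).1^* * u^* * u * (tnth (in_tuple v) j).1)%g
        (tnth (in_tuple v) j).2 (tnth (in_tuple v) i).2.
  rewrite /fsum_form big_map big_tnth; apply: eq_bigr => i _.
  rewrite big_map big_tnth; apply: eq_bigr => j _.
  by rewrite /kernel /= invgM !mulgA.
rewrite fsum_formE.
exact: (T_bounded u (fun i => (tnth (in_tuple v) i).1)
  (fun i => (tnth (in_tuple v) i).2)).
Qed.

Definition fsum_operator (u : G) : formalOperator fsum_preVE :=
  @FormalOperator R Z fsum_preVE (fsum_act u) (fsum_act u^*%g) (c u) (c u^*%g)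
    (c_ge0 u) (c_ge0 _) (fsum_act_adj u) (fsum_act_dominated u)
    (fsum_act_dominated _).

Local Notation K := (completion_VH fsum_preVE).

Definition dilation (u : G) : boundedAdjointable K :=
  extension_BA (fsum_operator u).

Lemma dilation_eval u (h : K) w :
  (dilation u h : completion _) w = (h : completion _) (fsum_act u^*%g w).
Proof. by []. Qed.

Lemma dilation_star_representation : star_representation dilation.
Proof.
split=> [s t k|s k f].
  apply: completion_eq => w; rewrite !dilation_eval; congr (_ _).
  rewrite /fsum_act -map_comp; apply: eq_map => b /=.
  by rewrite invgM mulgA.
apply: extension_adjoint => v /=; by rewrite invgK.
Qed.

(** The operator A of the factorisation: x is sent to the formal sum with the
    single entry x over the unit of G. *)
Definition generator (x : X) : K := embed (V := fsum_preVE) [:: (1%g, x)].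

Lemma generator_linear : linear generator.
Proof.
move=> a x y; apply: completion_eq => w.
change (fsum_form w [:: (1%g, a *: x + y)] =
  a *: fsum_form w [:: (1%g, x)] + fsum_form w [:: (1%g, y)]).
rewrite scaler_sumr -big_split; apply: eq_bigr => b _.
by rewrite !big_seq1 /kernel /= linearP.
Qed.

HB.instance Definition _ := GRing.isLinear.Build R[i] X K *:%R generator
  generator_linear.

Lemma generator_gram s x y :
  gram (generator y) (dilation s (generator x)) = T s x y.
Proof.
rewrite /= completion_gram_embed /= /fsum_form !big_seq1 /kernel /=.
by rewrite !mulg1 invgK.
Qed.

Hypothesis X_lb : locally_bounded X.
Hypothesis T_unit : in_Lc (T 1%g).

(** Local boundedness of X enters here, together with continuity of T 1 for
    uniform convergence on a bounded neighbourhood B of 0: for x small and in B,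
    T 1 x is small on all of B, hence at x. *)
Lemma generator_small p e : @incr_seminorm R Z p -> 0 < e ->
  nbhs 0 [set x | completion_norm p (generator x) < e].
Proof.
move=> pI e0; have [ps _ _] := pI; have [S TS] := T_unit.
have [B B0 Bb] := X_lb.
have Wn : nbhs (S 0) [set g : contDual X Z | forall y, B y -> p (g y - S 0 y) < e ^+ 2].
  by exists B, p, (e ^+ 2); split=> //; rewrite exprn_gt0.
have := @filterI _ _ (nbhs_filter (0 : X)) _ _ B0 (contLinear_continuous (x := 0) Wn).
apply: filterS => x [Bx /(_ _ Bx)].
have -> : S 0 x = 0 by rewrite -TS linear0.
rewrite subr0 -TS => h.
rewrite /completion_norm /= /pve_norm /= completion_gram_embed /=.
rewrite /fsum_form !big_seq1 /kernel /= invg1 mulg1.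
by rewrite -(@ltr_pXn2r _ 2)// ?nnegrE ?sqrtr_ge0 ?ltW// sqr_sqrtr// seminorm_ge0.
Qed.

Lemma generator_continuous : continuous (generator : X -> K).
Proof.
move=> x U /completion_nbhsP[p [e [pI e0 pU]]].
apply: filterS (nbhs0_translate x (generator_small pI e0)) => y /= yx.
by apply: pU => /=; rewrite -[generator y - _]raddfB.
Qed.

Definition generatorC : contLinear X K :=
  @ContLinear R X K (generator : {linear X -> K}) generator_continuous.

Lemma generator_bounded p (B : set X) : @incr_seminorm R Z p -> tvs_bounded B ->
  exists2 M, 0 < M & forall y, B y -> completion_norm p (generator y) <= M.
Proof.
move=> pI Bb; have [r r0 rB] := Bb _ (generator_small pI ltr01).
exists r => // y By; have [|u u1 <-] := rB r%:C _ _ By.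
  by rewrite ger0_norm// ler0c ltW.
rewrite linearZ seminorm_scale; last exact: completion_norm_seminorm.
by rewrite modulus_real ?(ltW r0)// ger_pMr// ltW.
Qed.

Lemma dilation_factor s x : T s x = Zadjoint generatorC (dilation s (generatorC x)).
Proof.
by apply: val_inj; apply/funext => y; exact/esym/generator_gram.
Qed.

(** For z in a bounded set, generator z stays bounded in norm, and the Schwarz
    inequality bounds T s y z - T s x z uniformly by the norm of the generator
    at y - x. *)
Lemma dilation_Lc s : in_Lc (T s).
Proof.
pose f x := Zadjoint generatorC (dilation s (generatorC x)).
have f_linear : linear f.
  move=> a x y; apply: val_inj; rewrite -[LHS]dilation_factor linearP.
  by rewrite !dilation_factor.
pose fL : {linear X -> contDual X Z} :=
  HB.pack f (GRing.isLinear.Build _ _ _ _ f f_linear).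
have fC : continuous fL.
  move=> x U [B [p [e [Bb pI e0 pU]]]]; have [ps _ _] := pI.
  have [M M0 BM] := generator_bounded pI Bb.
  have D0 : 0 < 4 * M * c s + 1 by rewrite ltr_wpDl// !mulr_ge0// ltW.
  have := nbhs0_translate x (generator_small pI (divr_gt0 e0 D0)).
  apply: filterS => y /= yx; apply: pU => z Bz.
  change (p (gram (generator z) (dilation s (generator y)) -
    gram (generator z) (dilation s (generator x))) < e).
  rewrite !generator_gram.
  have -> : T s y z - T s x z = T s (y - x) z by rewrite linearB.
  rewrite -generator_gram; apply: le_lt_trans (completion_schwarz _ _ pI) _.
  have := extension_norm (fsum_operator s) (generator (y - x)) pI.
  set N := completion_norm p (generator (y - x)) in yx *.
  have N0 : 0 <= N by exact: sqrtr_ge0.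
  move=> nN; have : completion_norm p (generator z) *
      completion_norm p (dilation s (generator (y - x))) <= M * (c s * N).
    by apply: ler_pM; rewrite ?sqrtr_ge0// BM.
  move: yx; rewrite ltr_pdivlMr//; lra.
by exists (ContLinear fC) => x; exact: dilation_factor.
Qed.

(** Inner products of g and h with dilation (u_ l) and with dilation u are within
    e / 4 of their values at lists w and v approximating g and h, uniformly in l;
    between lists the convergence is a finite sum of hypotheses on T. *)
Lemma dilation_weak_cvg (L : Type) (le : L -> L -> Prop) (u_ : L -> G) (u : G) :
  directed le -> has_ubound (range (c \o u_)) ->
  (forall s t : G,
    weak_cvg_Lc le (fun l => T (s * u_ l * t)%g) (T (s * u * t)%g)) ->
  weak_cvg_BA le (fun l => dilation (u_ l)) (dilation u).
Proof.
move=> le_dir [M0 M0u] Tu g h; have FF := tails_filter le_dir.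
have [M [uM lM]] : exists M, c u <= M /\ forall l, c (u_ l) <= M.
  exists (Num.max M0 (c u)); split=> [|l]; first by rewrite le_max lexx orbT.
  by rewrite le_max M0u//; exists l.
have M_ge0 : 0 <= M := le_trans (c_ge0 u) uM.
apply/tos_cvgP => p e pI e0; have [ps _ _] := pI.
have e40 : 0 < e / 4 by rewrite divr_gt0.
pose D := 4 * M * (completion_norm p g + completion_norm p h + 1) + 1.
have N0 (k : K) : 0 <= completion_norm p k by exact: sqrtr_ge0.
have D0 : 0 < D by rewrite ltr_wpDl// !mulr_ge0// !addr_ge0.
pose d := Num.min 1 (e / 4 / D).
have d0 : 0 < d by rewrite lt_min ltr01 divr_gt0.
have d1 : d <= 1 by rewrite ge_min lexx.
have dD : d * D <= e / 4 by rewrite -ler_pdivlMr// ge_min lexx orbT.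
have [w gw] := completionP g pI d0; have [v hv] := completionP h pI d0.
have close s : c s <= M ->
    p (gram g (dilation s h) - fsum_form w (fsum_act s v)) <= e / 4.
  move=> sM; apply: le_trans (extension_gram_approx (fsum_operator s) pI (ltW d0) gw hv) _.
  apply: le_trans dD; rewrite /D /=.
  set N := completion_norm p g + completion_norm p h.
  have NN : 0 <= N by rewrite addr_ge0.
  apply: (@le_trans _ _ (4 * M * d * (N + 1))).
    apply: ler_pM; rewrite ?mulr_ge0 ?addr_ge0 ?(ltW d0) ?c_ge0// ?lerD2l//.
    by rewrite ler_wpM2r ?(ltW d0)// ler_pM2l.
  by lra.
have fsum_cvg e' : 0 < e' -> tails le [set l |
    p (fsum_form w (fsum_act (u_ l) v) - fsum_form w (fsum_act u v)) < e'].
  apply: cvg_seminorm_sum => // a d' d'0.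
  have := @cvg_seminorm_sum _ _ L (G * X)%type (tails le) v
    (fun l b => kernel a ((u_ l * b.1)%g, b.2))
    (fun b => kernel a ((u * b.1)%g, b.2)) p FF pI.
  move=> /(_ _ d' d'0) H; apply: filterS (H _) => [l|b d'' d''0].
    by rewrite /= /fsum_act !big_map.
  have kE s : kernel a ((s * b.1)%g, b.2) = T (a.1^* * s * b.1)%g b.2 a.2.
    by rewrite /kernel /= mulgA.
  have Tub := (tos_cvgP _ (fmap_filter _ FF)).1 (Tu a.1^*%g b.1 a.2 b.2) p d'' pI d''0.
  by apply: (@filterS _ _ FF _ _ _ Tub) => l /=; rewrite !kE.
apply: filterS (fsum_cvg _ e40) => l.
change (is_true (p (fsum_form w (fsum_act (u_ l) v) - fsum_form w (fsum_act u v))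
  < e / 4) -> is_true (p (gram g (dilation (u_ l) h) - gram g (dilation u h)) < e)) => hl.
have hl1 := close _ (lM l); have hl2 := close _ uM.
apply: le_lt_trans (seminorm_triangle (fsum_form w (fsum_act (u_ l) v)) _ _ ps) _.
have := seminorm_triangle (fsum_form w (fsum_act u v))
  (fsum_form w (fsum_act (u_ l) v)) (gram g (dilation u h)) ps.
by rewrite [p (fsum_form w (fsum_act u v) - _)]seminormBC//; lra.
Qed.

End Dilation.

Theorem theorem5p7 (R : realType) (Z : admissibleSpace R) (G : starMonoidType)
    (X : topologicalLmodType R[i]) (X_lb : locally_bounded X)
    (T : G -> {linear X -> conjDual X Z})
    (T_psd : forall (n : nat) (s : 'I_n -> G) (x : 'I_n -> X),
      zle 0 (\sum_(i < n) \sum_(j < n) T ((s i)^* * s j)%g (x j) (x i)))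
    (c : G -> R) (c_ge0 : forall u : G, 0 <= c u)
    (T_bounded :
      forall (u : G) (n : nat) (s : 'I_n -> G) (x : 'I_n -> X),
      zle (\sum_(i < n) \sum_(j < n)
             T ((s i)^* * u^* * u * s j)%g (x j) (x i))
          ((c u ^+ 2)%:C *:
             (\sum_(i < n) \sum_(j < n) T ((s i)^* * s j)%g (x j) (x i))))
    (T_unit : in_Lc (T 1%g)) :
  exists (K : VHspace Z) (pi : G -> boundedAdjointable K)
      (A : contLinear X K),
    [/\ star_representation pi,
        forall (s : G) (x : X), T s x = Zadjoint A (pi s (A x)),
        forall s : G, in_Lc (T s)
      & forall (L : Type) (le : L -> L -> Prop) (u_ : L -> G) (u : G),
          directed le ->
          has_ubound (range (c \o u_)) ->
          (forall s t : G,
             weak_cvg_Lc le (fun l => T (s * u_ l * t)%g) (T (s * u * t)%g)) ->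
          weak_cvg_BA le (fun l => pi (u_ l)) (pi u)].
Proof.
exists (completion_VH (fsum_preVE T_psd)), (dilation T_psd c_ge0 T_bounded),
  (generatorC T_psd X_lb T_unit); split.
- exact: dilation_star_representation.
- exact: dilation_factor.
- exact: dilation_Lc.
- exact: dilation_weak_cvg.
Qed.
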